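(* Let $\mathbb{H}$ be a complex Hilbert space and let $T\in B(\mathbb{H})$. Then $$w^2(T)\leq \min_{t\in[0,1]}\left(\frac14 w(\widetilde{T}_t^{\,2})+\frac14\|T\|\,\|\widetilde{T}_t\|\right)+\frac14\|T^*T+TT^*\|.$$ In particular, $$w^2(T)\leq \frac14 w(\widetilde{T}^{\,2})+\frac14\|T\|\,\|\widetilde{T}\|+\frac14\|T^*T+TT^*\|.$$
   Context: $B(\mathbb{H})$ is the algebra of bounded linear operators on $\mathbb{H}$ and $\|\cdot\|$ the operator norm. The numerical radius is $w(T)=\sup\{|\langle Tx,x\rangle|: x\in\mathbb{H},\ \|x\|=1\}$, and $w^2(T)=(w(T))^2$. For $T\in B(\mathbb{H})$, $|T|=(T^*T)^{1/2}$ and $T=U|T|$ is the polar decomposition, with $U$ the partial isometry satisfying $\ker U=\ker T$. For $t\in[0,1]$ the $t$-Aluthge transform of $T$ is $\widetilde{T}_t=|T|^{t}U|T|^{1-t}$, with the convention $|T|^0:=U^*U$; $\widetilde{T}=\widetilde{T}_{1/2}=|T|^{1/2}U|T|^{1/2}$ is the Aluthge transform. $\widetilde{T}_t^{\,2}$ denotes the square $(\widetilde{T}_t)^2$ of the operator $\widetilde{T}_t$, and $\widetilde{T}^{\,2}=(\widetilde{T})^2$. *)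

(* Defs.v *)
From HB Require Import structures.
From mathcomp Require Import all_boot all_order all_algebra.
From mathcomp Require Import complex.
From mathcomp Require Import all_classical all_reals all_analysis.

Set Implicit Arguments.
Unset Strict Implicit.
Unset Printing Implicit Defensive.

Import Order.TTheory GRing.Theory Num.Theory.
Import numFieldNormedType.Exports.

Local Open Scope classical_set_scope.
Local Open Scope ring_scope.

(* The inner product is linear in its first argument and conjugate-linear in
   its second; [{dot H for Num.conj}] is the library's type of positive definite
   Hermitian forms.  Completeness is that of the normed module. *)
HB.mixin Record isHilbert (R : realType) H of CompleteNormedModule R[i] H := {
  inner : {dot H for (@Num.conj R[i])} ;
  normr_inner : forall x : H, `|x| ^+ 2 = inner x x
}.

#[short(type="hilbertType")]
HB.structure Definition Hilbert (R : realType) :=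
  {H of isHilbert R H & CompleteNormedModule R[i] H}.

Section Operators.
Context {R : realType} {H : hilbertType R}.
Implicit Types (A B S T U P : H -> H) (x y : H) (t : R).

Local Notation "<< x , y >>" := (@inner R H x y).

Definition bounded_op T := linear T /\ continuous T.

(* [`|_|] takes values in R[i], hence the [complex.Re]; both suprema below are
   genuine for bounded operators, and 0 on the zero space. *)
Definition opnorm T : R :=
  sup [set complex.Re `|T x| | x in [set x : H | `|x| <= 1]].

Definition num_radius T : R :=
  sup [set complex.Re `|<< T x, x >>| | x in [set x : H | `|x| = 1]].

Definition adjoint T : H -> H :=
  xget (fun=> 0) [set S | forall x y, << T x, y >> = << x, S y >>].

(* The order on R[i] makes [0 <= z] mean that z is real and nonnegative. *)
Definition positive_op A := forall x, 0 <= << A x, x >>.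

Definition op_abs T : H -> H :=
  xget (fun=> 0)
    [set P | [/\ bounded_op P, positive_op P & P \o P = adjoint T \o T]].

Definition partial_isometry U :=
  bounded_op U /\
  forall x, (forall y, U y = 0 -> << x, y >> = 0) -> `|U x| = `|x|.

Definition polar_part T : H -> H :=
  xget (fun=> 0)
    [set U | [/\ partial_isometry U,
                 (forall x, U x = 0 <-> T x = 0) &
                 T = U \o op_abs T]].

Definition poly_op (p : {poly R}) A : H -> H :=
  fun x => \sum_(i < size p) (p`_i)%:C%C *: iter i A x.

(* Continuous functional calculus f(A) of a positive operator A: the norm limit
   of p_n(A) for polynomials p_n converging to f uniformly on [0, ||A||], an
   interval that contains the spectrum of A. *)
Definition func_calc (f : R -> R) A : H -> H :=
  xget (fun=> 0)
    [set B | bounded_op B /\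
       exists p : nat -> {poly R},
         {uniform `[0, opnorm A], (fun n s => (p n).[s]) @ \oo --> f} /\
         opnorm (poly_op (p n) A \- B) @[n --> \oo] --> (0 : R)].

Definition abs_pow T t : H -> H :=
  if t == 0 then adjoint (polar_part T) \o polar_part T
  else func_calc (fun s => s `^ t) (op_abs T).

Definition aluthge t T : H -> H :=
  abs_pow T t \o polar_part T \o abs_pow T (1 - t).

End Operators.

Definition is_min (R : realType) (E : set R) (m : R) := E m /\ lbound E m.

(* Main.v *)
(* Write P = |T|, T = U P and A_t = P^t U P^(1-t), so that T^2 = X Y and
   A_t^2 = Y X for Y = P^t and X = U P^(1-t) A_t.  Expanding the square of
   Re(e^(i theta) T) gives
     |<Tx, x>|^2 <= 1/2 |<T^2 x, x>| + 1/4 <(T^*T + TT^* )x, x>   (|x| = 1),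
   and evaluating Z = XY + Y*X* at approximate eigenvectors gives
     2 w(XY) <= w(YX) + ||X|| ||Y||,
   where ||X|| ||Y|| <= ||T|| ||A_t||.  The minimum over t is attained because
   t |-> A_t is strongly continuous on [0, 1], so that w(A_t^2) and ||A_t||, as
   suprema of continuous functions of t, are lower semicontinuous.  The
   functional calculus of P rests on ||p(P)|| <= max |p| over [0, ||P||], obtained
   by factoring polynomials over the complex numbers. *)

Require Import Defs.
From HB Require Import structures.
From mathcomp Require Import all_boot all_order all_algebra.
From mathcomp Require Import complex.
From mathcomp Require Import all_classical all_reals all_analysis.
From mathcomp Require Import ring lra.

Set Implicit Arguments.
Unset Strict Implicit.
Unset Printing Implicit Defensive.

Import Order.TTheory GRing.Theory Num.Theory.
Import numFieldNormedType.Exports.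

Local Open Scope classical_set_scope.
Local Open Scope ring_scope.

(** * The underlying real inner product and norm *)

Section RealInner.
Context {R : realType} {H : hilbertType R}.
Implicit Types (x y z : H) (c : R).

(** Spectra are replaced by one notion, [bounded_below]: it passes to compositions, and S^2 -
    ||S||^2 is never bounded below for a nonzero bounded selfadjoint S. Squaring avoids deciding
    which of ||S|| and -||S|| is an approximate eigenvalue. This one fact yields both the norm
    estimate for polynomials in |T| and the swap inequality.

    The adjoint, |T|, U and |T|^t are picked by [xget], so nothing is known about them until an
    object with the required properties has been constructed: by Riesz, by a square root from the
    functional calculus, by extension from the range of |T|, by polynomial approximation.

    The minimum is delicate at t = 0, where |T|^0 = U*U lies outside the functional calculus and
    norm continuity can fail. Multiplying by |T| repairs this: s^(1+t) is Lipschitz in t uniformly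
    on [0, ||T||], and the closure of the range of |T| is all that |T|^t sees.

    Estimates are done with the real part of the inner product, so that they are inequalities in the
    ordered field R; a modulus is recovered through a unimodular factor. *)

Definition rinner x y : R := complex.Re (@inner R H x y).
Definition rnorm x : R := complex.Re `|x|.

Local Notation ip := (@inner R H).
Local Notation rp := rinner.
Local Notation nr := rnorm.
Local Notation "c %:C" := (real_complex R c).

Lemma innerC x y : ip x y = Num.conj (ip y x).
Proof. by rewrite hermC expr0 mul1r. Qed.

Lemma innerDl x y z : ip (x + y) z = ip x z + ip y z.
Proof. exact: linearDl. Qed.

Lemma innerZl (c : R[i]) x y : ip (c *: x) y = c * ip x y.
Proof. exact: linearZl_LR. Qed.

Lemma innerZr (c : R[i]) x y : ip x (c *: y) = Num.conj c * ip x y.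
Proof. exact: linearZr_LR. Qed.

Lemma conjCE (z : R[i]) : Num.conj z = (complex.Re z -i* complex.Im z)%C.
Proof. by case: z. Qed.

Lemma rinnerC x y : rp x y = rp y x.
Proof. by rewrite /rp innerC conjCE. Qed.

Lemma rinnerDl x y z : rp (x + y) z = rp x z + rp y z.
Proof. by rewrite /rp innerDl; case: (ip x z) => ? ?; case: (ip y z). Qed.

Lemma rinnerDr x y z : rp x (y + z) = rp x y + rp x z.
Proof. by rewrite !(rinnerC x) rinnerDl. Qed.

Lemma rinnerZl c x y : rp (c%:C *: x) y = c * rp x y.
Proof. by rewrite /rp innerZl; case: (ip x y) => ? ? /=; rewrite mul0r subr0. Qed.

Lemma rinnerZr c x y : rp x (c%:C *: y) = c * rp x y.
Proof. by rewrite !(rinnerC x) rinnerZl. Qed.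

Lemma rinnerNl x y : rp (- x) y = - rp x y.
Proof.
by rewrite -scaleN1r -(rmorph1 (real_complex R)) -rmorphN rinnerZl mulN1r.
Qed.

Lemma rinnerNr x y : rp x (- y) = - rp x y.
Proof. by rewrite !(rinnerC x) rinnerNl. Qed.

Lemma rinnerBl x y z : rp (x - y) z = rp x z - rp y z.
Proof. by rewrite rinnerDl rinnerNl. Qed.

Lemma rinnerBr x y z : rp x (y - z) = rp x y - rp x z.
Proof. by rewrite rinnerDr rinnerNr. Qed.

Lemma rinner0l x : rp 0 x = 0.
Proof. by rewrite -(subrr 0) rinnerBl subrr. Qed.

Lemma rinner0r x : rp x 0 = 0.
Proof. by rewrite rinnerC rinner0l. Qed.

Definition rinnerE := (rinnerDl, rinnerDr, rinnerNl, rinnerNr, rinnerZl,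
  rinnerZr, rinner0l, rinner0r).

Lemma Im_inner x y : complex.Im (ip x y) = rp x ('i%C *: y).
Proof.
rewrite /rp innerZr conjCE; case: (ip x y) => a b /=.
by rewrite mul0r mulN1r opprK add0r.
Qed.

(** Lets identities be proved for the real form and transferred to [inner], by using them for y and
    for iy. *)
Lemma inner_rinner x y : ip x y = (rp x y +i* rp x ('i%C *: y))%C.
Proof. by rewrite -Im_inner /rp; case: (ip x y). Qed.

Lemma rinneri x y : rp ('i%C *: x) y = - rp x ('i%C *: y).
Proof.
by rewrite -Im_inner /rp innerZl; case: (ip x y) => a b /=; rewrite mul0r mul1r sub0r.
Qed.

Lemma normr_rnorm x : `|x| = (nr x)%:C.
Proof.
have /ger0_Im : 0 <= `|x| by [].
by rewrite /nr; case: (`|x|) => a b /= ->.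
Qed.

Lemma rnorm_ge0 x : 0 <= nr x.
Proof. by rewrite -ler0c -normr_rnorm. Qed.

Lemma rnorm_sq x : nr x ^+ 2 = rp x x.
Proof.
have := @normr_inner R H x; rewrite normr_rnorm -rmorphXn /= /rp => <- //.
Qed.

Lemma rinner_ge0 x : 0 <= rp x x.
Proof. by rewrite -rnorm_sq sqr_ge0. Qed.

Lemma inner_self x : ip x x = (nr x ^+ 2)%:C.
Proof. by rewrite -normr_inner normr_rnorm rmorphXn. Qed.

Lemma rnorm0 : nr 0 = 0.
Proof. by rewrite /nr normr0. Qed.

Lemma rnorm_eq0 x : nr x = 0 -> x = 0.
Proof. by move=> h; apply/normr0_eq0; rewrite normr_rnorm h. Qed.

Lemma rnorm_gt0 x : x != 0 -> 0 < nr x.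
Proof.
move=> x0; rewrite lt_neqAle rnorm_ge0 andbT eq_sym.
by apply: contra x0 => /eqP /rnorm_eq0 ->.
Qed.

Lemma rnormD x y : nr (x + y) <= nr x + nr y.
Proof. by rewrite -lecR rmorphD /= -!normr_rnorm ler_normD. Qed.

Lemma rnormN x : nr (- x) = nr x.
Proof. by rewrite /nr normrN. Qed.

Lemma rnormBC x y : nr (x - y) = nr (y - x).
Proof. by rewrite -rnormN opprB. Qed.

Lemma rnormB x y : nr (x - y) <= nr x + nr y.
Proof. by rewrite -(rnormN y) rnormD. Qed.

Lemma rnorm_dist x y : nr x <= nr y + nr (x - y).
Proof. by rewrite -{1}(subrKC y x) rnormD. Qed.

Lemma rnormZ (c : R[i]) x : nr (c *: x) = complex.Re `|c| * nr x.
Proof. by rewrite /nr normrZ !normr_rnorm normc_def /= !mul0r subr0. Qed.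

Lemma rnormZr c x : nr (c%:C *: x) = `|c| * nr x.
Proof. by rewrite rnormZ normc_def /= expr0n addr0 sqrtr_sqr. Qed.

Lemma rnormi x : nr ('i%C *: x) = nr x.
Proof. by rewrite rnormZ normc_def /= expr0n expr1n add0r sqrtr1 mul1r. Qed.

Lemma rinner_eq0 x : (forall y, rp x y = 0) -> x = 0.
Proof.
by move=> h; apply/rnorm_eq0/eqP; rewrite -sqrf_eq0 rnorm_sq h.
Qed.

Lemma rinner_inj x y : (forall z, rp x z = rp y z) -> x = y.
Proof.
by move=> h; apply/subr0_eq/rinner_eq0 => z; rewrite rinnerBl h subrr.
Qed.

(** The square of the norm of |y|x - |x|y equals 2|x||y| (|x||y| - rp x y), and it is
    nonnegative. *)
Lemma rinner_le x y : rp x y <= nr x * nr y.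
Proof.
have [->|y0] := eqVneq y 0; first by rewrite rinner0r rnorm0 mulr0.
have [->|x0] := eqVneq x 0; first by rewrite rinner0l rnorm0 mul0r.
have := rinner_ge0 ((nr y)%:C *: x - (nr x)%:C *: y).
rewrite !rinnerE -!rnorm_sq (rinnerC y x) => h.
have hx := rnorm_gt0 x0; have hy := rnorm_gt0 y0.
have hxy : 0 < nr x * nr y by exact: mulr_gt0.
rewrite -(ler_pM2l hxy); lra.
Qed.

Lemma rinner_norm_le x y : `|rp x y| <= nr x * nr y.
Proof.
rewrite ler_norml rinner_le andbT lerNl -rinnerNl.
by apply: le_trans (rinner_le _ _) _; rewrite rnormN.
Qed.

(** Multiplying by u turns a modulus into a real part, so that bounds on [rinner] become bounds on
    the modulus of [inner]. *)
Lemma phase_exists (z : R[i]) :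
  exists2 u : R[i], complex.Re `|u| = 1 & u * z = (complex.Re `|z|)%:C.
Proof.
have nz : (complex.Re `|z|)%:C = `|z| by rewrite normc_def.
have [->|z0] := eqVneq z 0.
  by exists 1; [rewrite normr1 | rewrite mulr0 normr0].
exists (`|z| / z); last by rewrite divfK // nz.
by rewrite normf_div normr_id divff ?normr_eq0.
Qed.

Lemma inner_norm_le x y : complex.Re `|ip x y| <= nr x * nr y.
Proof.
have [u u1 uz] := phase_exists (ip x y).
have := rinner_le (u *: x) y.
by rewrite rnormZ u1 mul1r /rp innerZl uz.
Qed.

Lemma parallelogram x y :
  nr (x + y) ^+ 2 + nr (x - y) ^+ 2 = 2 * nr x ^+ 2 + 2 * nr y ^+ 2.
Proof. rewrite !rnorm_sq !rinnerE; ring. Qed.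

Lemma rnorm_sqD x y : nr (x + y) ^+ 2 = nr x ^+ 2 + 2 * rp x y + nr y ^+ 2.
Proof. rewrite !rnorm_sq !rinnerE (rinnerC y x); ring. Qed.

Lemma rnorm_sqB x y : nr (x - y) ^+ 2 = nr x ^+ 2 - 2 * rp x y + nr y ^+ 2.
Proof. rewrite !rnorm_sq !rinnerE (rinnerC y x); ring. Qed.

Lemma rnorm_complete (u : nat -> H) :
  (forall e : R, 0 < e -> exists N, forall m n, (N <= m)%N -> (N <= n)%N ->
     nr (u m - u n) < e) ->
  exists l, forall e : R, 0 < e -> exists N, forall n, (N <= n)%N -> nr (u n - l) < e.
Proof.
move=> hc.
have cu : cauchy (u @ \oo).
  apply/cauchy_ballP => e e0.
  (* Radii of balls live in R[i], where 0 < e forces e to be real. *)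
  have he : e = (complex.Re e)%:C by move: e0; case: e => a b; rewrite ltcE /= => /andP[/eqP -> _].
  have e0' : 0 < complex.Re e by move: e0; rewrite {1}he ltcR.
  have [N hN] := hc _ e0'.
  exists (u @` [set n | (N <= n)%N], u @` [set n | (N <= n)%N]) => /=.
    by split; exists N => // n Nn; exists n.
  move=> [_ _] /= [[m hm <-] [n hn <-]]; rewrite -ball_normE /= normr_rnorm he ltcR; exact: hN.
have /cvg_ex[l hl] : cvg (u @ \oo) by exact: cauchy_cvg.
exists l => e e0.
have eC : 0 < e%:C by rewrite ltcR.
move/cvgrPdist_lt: hl => /(_ _ eC) [N _ hN].
by exists N => n /hN /=; rewrite normr_rnorm ltcR rnormBC.
Qed.

End RealInner.

(** * Elementary epsilon arguments *)

Section Reals.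
Context {R : realType}.

(** Stands in for letting e tend to 0; e <= 1 lets a caller bound e^2 by e. If x > 0, then e = x /
    (C + 1 + x) gives e * C < x. *)
Lemma le0_eps (x C : R) : 0 <= C ->
  (forall e : R, 0 < e -> e <= 1 -> x <= e * C) -> x <= 0.
Proof.
move=> C0 h; rewrite leNgt; apply/negP => x0.
have C1 : 0 < C + 1 + x by lra.
have e0 : 0 < x / (C + 1 + x) by rewrite divr_gt0.
have e1 : x / (C + 1 + x) <= 1 by rewrite ler_pdivrMr//; lra.
have := h _ e0 e1; rewrite mulrAC ler_pdivlMr //.
have := mulr_ge0 (ltW x0) C0 => h1 h2; nra.
Qed.

Lemma sq_le (x y : R) : 0 <= y -> x ^+ 2 <= y ^+ 2 -> x <= y.
Proof.
move=> y0 h; rewrite (le_trans (ler_norm x)) // -ler_sqr ?nnegrE //.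
by rewrite real_normK ?num_real.
Qed.

Lemma invS_small (e : R) : 0 < e -> exists N : nat, forall n, (N <= n)%N -> n.+1%:R^-1 < e.
Proof.
move=> e0; have [N _ hN] := near_infty_natSinv_lt (PosNum e0).
by exists N => n /hN.
Qed.

End Reals.

(** * Riesz representation on real subspaces *)

Section Riesz.
Context {R : realType} {H : hilbertType R}.
Implicit Types (x y z : H).

Local Notation rp := rinner.
Local Notation nr := rnorm.
Local Notation "c %:C" := (real_complex R c).

(** With L the whole space the representation below gives adjoints; with L the range of an operator
    it gives the orthogonal projection onto the closure of that range. *)
Definition real_subspace (L : set H) :=
  [/\ L 0, forall x y, L x -> L y -> L (x + y) &
      forall (c : R) x, L x -> L (c%:C *: x)].

(* The representing vector is the limit of a minimizing sequence of
   [|z|^2 - 2 f z] over L. *)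
Lemma riesz_subspace (L : set H) (f : H -> R) (c : R) :
  real_subspace L ->
  (forall x y, f (x + y) = f x + f y) ->
  (forall (a : R) x, f (a%:C *: x) = a * f x) ->
  (forall x, f x <= c * nr x) ->
  exists2 s, (forall e : R, 0 < e -> exists2 z, L z & nr (z - s) < e) &
             forall z, L z -> f z = rp z s.
Proof.
move=> [L0 LD LZ] fD fZ fc.
pose J z := nr z ^+ 2 - 2 * f z.
have Jlb z : - c ^+ 2 <= J z.
  have := fc z; have := sqr_ge0 (nr z - c); rewrite /J => h1 h2; nra.
have JD z w (t : R) : J (z + t%:C *: w) = J z + 2 * t * (rp z w - f w) + t ^+ 2 * nr w ^+ 2.
  by rewrite /J rnorm_sqD fD fZ rnormZr rinnerE exprMn real_normK ?num_real //; ring.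
pose E := [set J z | z in L].
have hE : has_inf E.
  by split; [exists (J 0); exists 0 | exists (- c ^+ 2) => _ [z _ <-]].
pose m := inf E.
have mJ z : L z -> m <= J z.
  by move=> Lz; apply: (ge_inf (proj2 hE)); exists z.
have hz (n : nat) : exists z, L z /\ J z < m + n.+1%:R^-1.
  have [||_ [z Lz <-] h] := @inf_adherent _ E n.+1%:R^-1 => //.
  by exists z.
have [u hu] := choice hz.
(* By the parallelogram law, |u - v|^2 = 2 J u + 2 J v - 4 J((u + v) / 2), and the midpoint lies in
   L, so its J is at least m. *)
have cau m1 n : nr (u m1 - u n) ^+ 2 <= 2 * m1.+1%:R^-1 + 2 * n.+1%:R^-1.
  have [Lm hm] := hu m1; have [Ln hn] := hu n.
  have := mJ _ (LZ (2^-1) _ (LD _ _ Lm Ln)).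
  have := parallelogram (u m1) (u n).
  move: hm hn; rewrite /J rnormZr fZ fD ger0_norm ?invr_ge0 // exprMn.
  have -> : (2^-1 : R) ^+ 2 = 4^-1 by field.
  move: (m1.+1%:R^-1) (n.+1%:R^-1) => p q; lra.
have [|s hs] := @rnorm_complete _ _ u.
  move=> e e0.
  have e40 : 0 < e ^+ 2 / 4 by rewrite divr_gt0 // exprn_gt0.
  have [N hN] := invS_small e40; exists N => p q /hN hp /hN hq.
  rewrite -(ltr_sqr (rnorm_ge0 _)) ?nnegrE ?ltW //.
  apply: le_lt_trans (cau _ _) _.
  move: (p.+1%:R^-1) (q.+1%:R^-1) hp hq => a b; lra.
exists s.
  by move=> e /hs[N /(_ _ (leqnn N)) hN]; exists (u N) => //; case: (hu N).
move=> z Lz; apply/eqP; rewrite -subr_eq0 -sqrf_eq0 eq_le sqr_ge0 andbT.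
apply: (@le0_eps _ _ (4 * nr z ^+ 2)) => [|e e0 e1].
  by rewrite mulr_ge0 // sqr_ge0.
have [N1 hN1] := invS_small e0; have [N2 hN2] := hs _ e0.
pose n := maxn N1 N2.
have {hN1} hn1 := hN1 n (leq_maxl _ _); have {hN2} hn2 := hN2 n (leq_maxr _ _).
have [z0|z0] := eqVneq z 0.
  by have := fZ 0 0; rewrite scaler0 mul0r z0 rinner0l => ->; rewrite rnorm0; lra.
have q0 : 0 < nr z ^+ 2 by rewrite exprn_gt0 // rnorm_gt0.
set q := nr z ^+ 2 in q0 *.
pose a := rp (u n) z - f z.
have ha : a ^+ 2 <= q * e.
  have [Lu hJ] := hu n.
  (* Along the line through [u n] in direction z, J is smallest at parameter -a/q, where it has
     dropped by a^2/q; since J (u n) is within 1/(n+1) of its infimum, a^2/q <= e. *)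
  have := mJ _ (LD _ _ Lu (LZ (- a / q) _ Lz)); rewrite JD -/q -/a.
  have -> : J (u n) + 2 * (- a / q) * a + (- a / q) ^+ 2 * q = J (u n) - a ^+ 2 / q.
    by field; rewrite gt_eqF.
  move=> h; have : a ^+ 2 / q <= e.
    by move: (n.+1%:R^-1) (a ^+ 2 / q) hn1 hJ h => v w; lra.
  by rewrite ler_pdivrMr // mulrC.
have hb : (rp (u n - s) z) ^+ 2 <= q * e.
  have h1 : `|rp (u n - s) z| <= e * nr z.
    apply: le_trans (rinner_norm_le _ _) _; apply: ler_wpM2r (ltW hn2).
    exact: rnorm_ge0.
  rewrite -real_normK ?num_real //.
  apply: (@le_trans _ _ ((e * nr z) ^+ 2)).
    by rewrite ler_sqr ?nnegrE ?mulr_ge0 ?rnorm_ge0 // ltW.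
  rewrite exprMn -/q mulrC ler_pM2l // expr2 ger_pMl //.
have -> : f z - rp z s = rp (u n - s) z - a.
  by rewrite /a rinnerBl (rinnerC z s); ring.
have := sqr_ge0 (rp (u n - s) z + a); nra.
Qed.

End Riesz.

(** * Bounded operators, operator norm, numerical radius and adjoint *)

Section BoundedOperators.
Context {R : realType} {H : hilbertType R}.
Implicit Types (A B S T : H -> H) (x y z : H).

Local Notation ip := (@inner R H).
Local Notation rp := rinner.
Local Notation nr := rnorm.
Local Notation "c %:C" := (real_complex R c).

Section Linear.
Variables (A : H -> H) (lA : linear A).

Lemma linop0 : A 0 = 0.
Proof. by have := lA (-1) 0 0; rewrite !scaleN1r addNr addNr. Qed.

Lemma linopD x y : A (x + y) = A x + A y.
Proof. by have := lA 1 x y; rewrite !scale1r. Qed.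

Lemma linopZ c x : A (c *: x) = c *: A x.
Proof. by have := lA c x 0; rewrite !addr0 linop0 addr0. Qed.

Lemma linopN x : A (- x) = - A x.
Proof. by rewrite -scaleN1r linopZ scaleN1r. Qed.

Lemma linopB x y : A (x - y) = A x - A y.
Proof. by rewrite linopD linopN. Qed.

End Linear.

Lemma linear_comp A B : linear A -> linear B -> linear (A \o B).
Proof. by move=> lA lB c x y /=; rewrite lB lA. Qed.

Lemma linear_addf A B : linear A -> linear B -> linear (A \+ B).
Proof. by move=> lA lB c x y /=; rewrite lA lB scalerDr addrACA. Qed.

Lemma linear_subf A B : linear A -> linear B -> linear (A \- B).
Proof. by move=> lA lB c x y /=; rewrite lA lB scalerBr opprD addrACA. Qed.

Lemma bounded_opP A :
  bounded_op A <-> linear A /\ exists c : R, forall x, nr (A x) <= c * nr x.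
Proof.
split=> [[lA cA]|[lA [c hc]]]; split=> //.
  have /cvgrPdist_lt/(_ 1 ltr01) := cA 0.
  rewrite linop0 // => /nbhs_ballP[d /= d0 hd].
  have dE : d = (complex.Re d)%:C.
    by move: d0; rewrite ltcE; case: (d) => a b /= /andP[/eqP -> _].
  have d0' : 0 < complex.Re d by move: d0; rewrite {1}dE ltcR.
  (* The vector x is rescaled to norm d/2, inside the ball of radius d on which A has norm below
     1. *)
  exists (2 / complex.Re d) => x.
  have [->|x0] := eqVneq x 0; first by rewrite linop0 // rnorm0 mulr0.
  have nx := rnorm_gt0 x0.
  pose k := complex.Re d / (2 * nr x).
  have k0 : 0 < k by rewrite divr_gt0 // mulr_gt0.
  have : nr (A (k%:C *: x)) < 1.
    have := hd (k%:C *: x); rewrite -ball_normE /= !sub0r !normrN !normr_rnorm.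
    rewrite {1}dE -(rmorph1 (real_complex R)) !ltcR; apply.
    rewrite rnormZr gtr0_norm // /k invfM mulrA mulrVK ?unitfE ?gt_eqF //.
    rewrite ltr_pdivrMr //; lra.
  have e1 : k * (2 / complex.Re d * nr x) = 1.
    by rewrite /k; field; rewrite !gt_eqF.
  rewrite linopZ // rnormZr gtr0_norm // => h; apply: ltW.
  by rewrite -(ltr_pM2l k0) e1.
move=> x; apply/cvgrPdist_lt => e e0.
have eE : e = (complex.Re e)%:C.
  by move: e0; rewrite ltcE; case: (e) => a b /= /andP[/eqP -> _].
have e0' : 0 < complex.Re e by move: e0; rewrite {1}eE ltcR.
have c1 : 0 < `|c| + 1 by rewrite ltr_wpDl.
apply/nbhs_ballP; exists (complex.Re e / (`|c| + 1))%:C => /=.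
  by rewrite ltcR divr_gt0.
move=> y; rewrite -ball_normE /= !normr_rnorm eE !ltcR -linopB // => h.
apply: le_lt_trans (hc _) _.
apply: (@le_lt_trans _ _ ((`|c| + 1) * nr (x - y))).
  apply: ler_wpM2r; first exact: rnorm_ge0.
  by apply: le_trans (ler_norm c) _; rewrite lerDl.
by rewrite mulrC -ltr_pdivlMr.
Qed.

Lemma bounded_op_linear A : bounded_op A -> linear A.
Proof. by case. Qed.

Lemma normr_le1 x : (`|x| <= 1) = (nr x <= 1).
Proof. by rewrite normr_rnorm -(rmorph1 (real_complex R)) lecR. Qed.

Lemma normr_eq1 x : `|x| = 1 <-> nr x = 1.
Proof.
rewrite normr_rnorm -(rmorph1 (real_complex R)).
by split=> [/complexI|->].
Qed.

Lemma opnorm_ge0 A : 0 <= opnorm A.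
Proof.
rewrite /opnorm; set E := [set _ | _ in _].
(* For an unbounded A the supremum defaults to 0, so no boundedness has to be assumed. *)
have [hE|/sup_out -> //] := pselect (has_sup E).
apply: (le_trans (rnorm_ge0 (A 0))); apply: sup_upper_bound => //.
by exists 0 => //=; rewrite normr0.
Qed.

Lemma opnorm_ub A x : bounded_op A -> nr (A x) <= opnorm A * nr x.
Proof.
move=> bA; have /bounded_opP[lA [c hc]] := bA.
have [->|x0] := eqVneq x 0; first by rewrite linop0 // rnorm0 mulr0.
have nx := rnorm_gt0 x0.
have : nr (A ((nr x)^-1%:C *: x)) <= opnorm A.
  apply: ub_le_sup.
    exists `|c| => _ [y /= y1 <-]; apply: le_trans (hc y) _.
    apply: (@le_trans _ _ (`|c| * nr y)).
      by apply: ler_wpM2r; [exact: rnorm_ge0 | exact: ler_norm].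
    rewrite -{2}(mulr1 `|c|); apply: ler_wpM2l => //.
    by rewrite -normr_le1.
  exists ((nr x)^-1%:C *: x) => //=.
  by rewrite normr_le1 rnormZr gtr0_norm ?invr_gt0 // mulVf ?gt_eqF.
rewrite linopZ // rnormZr gtr0_norm ?invr_gt0 // mulrC.
by rewrite ler_pdivrMr.
Qed.

Lemma opnorm_le A (c : R) :
  0 <= c -> (forall x, nr (A x) <= c * nr x) -> opnorm A <= c.
Proof.
move=> c0 hc; apply: ge_sup.
  by exists (nr (A 0)); exists 0 => //=; rewrite normr0.
move=> _ [y /= y1 <-]; apply: le_trans (hc y) _.
rewrite -{2}(mulr1 c); apply: ler_wpM2l => //.
by rewrite -normr_le1.
Qed.

Lemma bounded_op_of A (c : R) :
  linear A -> (forall x, nr (A x) <= c * nr x) -> bounded_op A.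
Proof. by move=> lA hc; apply/bounded_opP; split => //; exists c. Qed.

Lemma bounded_op_comp A B : bounded_op A -> bounded_op B -> bounded_op (A \o B).
Proof.
move=> bA bB; apply: (@bounded_op_of _ (opnorm A * opnorm B)).
  by apply: linear_comp; apply: bounded_op_linear.
move=> x /=; apply: le_trans (opnorm_ub _ bA) _.
by rewrite -mulrA ler_wpM2l ?opnorm_ge0 ?opnorm_ub.
Qed.

Lemma bounded_op_add A B : bounded_op A -> bounded_op B -> bounded_op (A \+ B).
Proof.
move=> bA bB; apply: (@bounded_op_of _ (opnorm A + opnorm B)).
  by apply: linear_addf; apply: bounded_op_linear.
by move=> x /=; apply: le_trans (rnormD _ _) _; rewrite mulrDl lerD ?opnorm_ub.
Qed.

Lemma bounded_op_sub A B : bounded_op A -> bounded_op B -> bounded_op (A \- B).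
Proof.
move=> bA bB; apply: (@bounded_op_of _ (opnorm A + opnorm B)).
  by apply: linear_subf; apply: bounded_op_linear.
by move=> x /=; apply: le_trans (rnormB _ _) _; rewrite mulrDl lerD ?opnorm_ub.
Qed.

Lemma bounded_op_id : bounded_op (@idfun H).
Proof. by apply: (@bounded_op_of _ 1) => [c x y|x] //; rewrite mul1r. Qed.

Lemma bounded_op0 : bounded_op (fun _ : H => 0 : H).
Proof.
by apply: (@bounded_op_of _ 0) => [c x y|x]; rewrite ?scaler0 ?addr0 ?rnorm0 ?mul0r.
Qed.

Lemma normc_ge0 (z : R[i]) : 0 <= complex.Re `|z|.
Proof. by rewrite normc_def /= sqrtr_ge0. Qed.

Lemma num_radius_ge0 A : 0 <= num_radius A.
Proof.
rewrite /num_radius; set E := [set _ | _ in _].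
have [hE|/sup_out -> //] := pselect (has_sup E).
have [[r [x x1 xr]] _] := hE.
apply: (le_trans (normc_ge0 (ip (A x) x))).
by apply: sup_upper_bound => //; exists x.
Qed.

Lemma num_radius_ub1 A x : bounded_op A -> nr x = 1 ->
  complex.Re `|ip (A x) x| <= num_radius A.
Proof.
move=> bA x1; apply: ub_le_sup; last first.
  by exists x => //=; apply/normr_eq1.
exists (opnorm A) => _ [y /= y1 <-].
move/normr_eq1: y1 => y1.
apply: le_trans (inner_norm_le _ _) _; rewrite y1 mulr1.
by apply: le_trans (opnorm_ub _ bA) _; rewrite y1 mulr1.
Qed.

Lemma num_radius_le A (c : R) : 0 <= c ->
  (forall x, nr x = 1 -> complex.Re `|ip (A x) x| <= c) -> num_radius A <= c.
Proof.
move=> c0 hc; rewrite /num_radius; set E := [set _ | _ in _].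
(* On the zero space there are no unit vectors and [sup] defaults to 0; this case is settled by 0 <=
   c. *)
have [[hE _]|/sup_out -> //] := pselect (has_sup E).
apply: ge_sup => // _ [y /= y1 <-]; apply: hc.
exact/normr_eq1.
Qed.

Lemma conjC_real (a : R) : Num.conj a%:C = a%:C.
Proof. by rewrite conjCE /= oppr0. Qed.

Lemma Re_mulR (a : R) (z : R[i]) : complex.Re (a%:C * z) = a * complex.Re z.
Proof. by case: z => x y /=; rewrite mul0r subr0. Qed.

Lemma num_radius_ub A x : bounded_op A ->
  complex.Re `|ip (A x) x| <= num_radius A * nr x ^+ 2.
Proof.
move=> bA; have lA := bounded_op_linear bA.
have [->|x0] := eqVneq x 0.
  by rewrite linop0 // inner_self rnorm0 expr0n mulr0 normr0.
have nx := rnorm_gt0 x0.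
have x1 : nr ((nr x)^-1%:C *: x) = 1.
  by rewrite rnormZr gtr0_norm ?invr_gt0 // mulVf ?gt_eqF.
have := num_radius_ub1 bA x1.
rewrite linopZ // innerZl innerZr conjC_real !normrM.
have nR (a : R) : 0 < a -> `|a%:C| = a%:C.
  by move=> a0; rewrite gtr0_norm // ltcR.
rewrite nR ?invr_gt0 // !Re_mulR mulrA -invfM -expr2 mulrC.
by rewrite ler_pdivrMr ?exprn_gt0.
Qed.

Lemma adjoint_exists T : bounded_op T ->
  exists S : H -> H, forall x y, ip (T x) y = ip x (S y).
Proof.
move=> bT; have lT := bounded_op_linear bT.
suff h y : exists s, forall x, ip (T x) y = ip x s.
  by have [S hS] := choice h; exists S.
have [|x z|a x|x|s _ hs] := @riesz_subspace _ _ setT (fun x => rinner (T x) y) (opnorm T * nr y).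
- by split.
- by rewrite linopD // rinnerDl.
- by rewrite linopZ // rinnerZl.
- apply: le_trans (rinner_le _ _) _; rewrite mulrAC ler_wpM2r ?rnorm_ge0 //.
  exact: opnorm_ub.
(* Riesz gave equality of real parts; the imaginary parts agree by applying that equality to ix. *)
exists s => x; rewrite !inner_rinner hs //; congr (_ +i* _)%C.
by rewrite -[LHS]opprK -rinneri -linopZ // hs // rinneri opprK.
Qed.

Lemma adjointP T : bounded_op T -> forall x y, ip (T x) y = ip x (adjoint T y).
Proof.
move=> /adjoint_exists[S hS]; rewrite /adjoint.
by case: xgetP => [S' _ //|/(_ S)].
Qed.

Lemma adjoint_rinner T x y : bounded_op T -> rp (T x) y = rp x (adjoint T y).
Proof. by move=> bT; rewrite /rinner adjointP. Qed.

Lemma adjoint_bound T x : bounded_op T -> nr (adjoint T x) <= opnorm T * nr x.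
Proof.
move=> bT; set s := adjoint T x.
have [s0|s0] := eqVneq s 0.
  by rewrite s0 rnorm0 mulr_ge0 ?opnorm_ge0 ?rnorm_ge0.
have ns := rnorm_gt0 s0; rewrite -(ler_pM2l ns) -expr2 rnorm_sq -adjoint_rinner //.
apply: le_trans (rinner_le _ _) _; rewrite mulrA ler_wpM2r ?rnorm_ge0 // mulrC.
exact: opnorm_ub.
Qed.

Lemma adjoint_bounded T : bounded_op T -> bounded_op (adjoint T).
Proof.
move=> bT; apply: (@bounded_op_of _ (opnorm T)); last by move=> x; exact: adjoint_bound.
move=> c x y; apply: rinner_inj => z; rewrite !(rinnerC _ z).
rewrite -adjoint_rinner // !rinnerDr -adjoint_rinner //.
by congr (_ + _); rewrite /rinner !innerZr adjointP.
Qed.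

End BoundedOperators.

(** * Polynomials in a positive operator and their norms *)

Section PolynomialCalculus.
Context {R : realType} {H : hilbertType R}.
Implicit Types (A B S : H -> H) (x y z : H).

Local Notation rp := rinner.
Local Notation nr := rnorm.
Local Notation "c %:C" := (real_complex R c).

(** For complex-linear A this real condition is equivalent to symmetry with respect to [inner],
    since i can be moved through A. *)
Definition selfadjoint A := forall x y, rp (A x) y = rp x (A y).

Lemma selfadjoint_rinneri A x : linear A -> selfadjoint A ->
  rp (A x) ('i%C *: x) = 0.
Proof.
move=> lA sA; have h1 := sA x ('i%C *: x).
move: h1; rewrite [X in _ = X]rinnerC linopZ // rinneri => h1.
by lra.
Qed.

(** For A - r in place of A this says that r is not an approximate eigenvalue of A. *)
Definition bounded_below A := exists2 d : R, 0 < d & forall x, d * nr x <= nr (A x).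

Lemma bounded_below_comp A B :
  bounded_below A -> bounded_below B -> bounded_below (A \o B).
Proof.
move=> [a a0 ha] [b b0 hb]; exists (a * b); first exact: mulr_gt0.
move=> x /=; apply: le_trans (ha _); rewrite -mulrA ler_pM2l //.
Qed.

Lemma bounded_op_scale A (c : R[i]) :
  bounded_op A -> bounded_op (fun x => c *: A x).
Proof.
move=> bA; apply: (@bounded_op_of _ _ _ (complex.Re `|c| * opnorm A)).
  by move=> k x y; rewrite (bounded_op_linear bA) scalerDr !scalerA mulrC.
by move=> x; rewrite rnormZ -mulrA ler_wpM2l ?normc_ge0 ?opnorm_ub.
Qed.

Definition cpoly_op (p : {poly R[i]}) A x : H :=
  \sum_(i < size p) p`_i *: iter i A x.

Lemma cpoly_op_wide n (p : {poly R[i]}) A x : (size p <= n)%N ->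
  cpoly_op p A x = \sum_(i < n) p`_i *: iter i A x.
Proof.
move=> hn; rewrite /cpoly_op (big_ord_widen _ (fun i => p`_i *: iter i A x) hn).
rewrite big_mkcond; apply: eq_bigr => i _; case: ltnP => // h.
by rewrite nth_default // scale0r.
Qed.

Lemma cpoly_opD p q A x : cpoly_op (p + q) A x = cpoly_op p A x + cpoly_op q A x.
Proof.
pose n := maxn (size p) (size q).
rewrite (@cpoly_op_wide n (p + q)) ?size_polyD //.
rewrite (@cpoly_op_wide n p) ?leq_maxl // (@cpoly_op_wide n q) ?leq_maxr //.
by rewrite -big_split; apply: eq_bigr => i _; rewrite coefD scalerDl.
Qed.

Lemma cpoly_opZ c p A x : cpoly_op (c *: p) A x = c *: cpoly_op p A x.
Proof.
rewrite (@cpoly_op_wide (size p)) ?size_scale_leq // /cpoly_op scaler_sumr.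
by apply: eq_bigr => i _; rewrite coefZ scalerA.
Qed.

Lemma cpoly_opC c A x : cpoly_op c%:P A x = c *: x.
Proof.
rewrite (@cpoly_op_wide 1) ?size_polyC_leq1 // big_ord1 coefC //.
Qed.

Lemma cpoly_opMX p A x : cpoly_op (p * 'X) A x = cpoly_op p A (A x).
Proof.
rewrite (@cpoly_op_wide (size p).+1); last first.
  by apply: leq_trans (size_polyMleq _ _) _; rewrite size_polyX addn2.
rewrite big_ord_recl coefMX /= scale0r add0r.
by apply: eq_bigr => i _; rewrite coefMX /= -iterSr.
Qed.

Lemma cpoly_op_comm p A x : linear A -> cpoly_op p A (A x) = A (cpoly_op p A x).
Proof.
move=> lA; elim/poly_ind: p x => [|p c IH] x.
  by rewrite -[0]/(0%:P) !cpoly_opC !scale0r (linop0 lA).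
by rewrite !cpoly_opD !cpoly_opMX !cpoly_opC (linopD lA) IH (linopZ lA).
Qed.

Lemma cpoly_opM p q A x : linear A ->
  cpoly_op (p * q) A x = cpoly_op p A (cpoly_op q A x).
Proof.
move=> lA; elim/poly_ind: p x => [|p c IH] x.
  by rewrite mul0r -[0]/(0%:P) !cpoly_opC !scale0r.
rewrite mulrDl -mulrA ['X * q]mulrC mulrA mul_polyC !cpoly_opD cpoly_opZ cpoly_opC.
by rewrite !cpoly_opMX IH (cpoly_op_comm q).
Qed.

Lemma cpoly_op_bounded p A : bounded_op A -> bounded_op (cpoly_op p A).
Proof.
move=> bA; elim/poly_ind: p => [|p c IH].
  have -> : cpoly_op 0 A = (fun _ => 0); last exact: bounded_op0.
  by apply: funext => x; rewrite -[X in cpoly_op X]/(0%:P) cpoly_opC scale0r.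
have -> : cpoly_op (p * 'X + c%:P) A = (cpoly_op p A \o A) \+ (fun x => c *: idfun x).
  by apply: funext => x; rewrite cpoly_opD cpoly_opMX cpoly_opC.
apply: bounded_op_add; first exact: bounded_op_comp.
exact: bounded_op_scale bounded_op_id.
Qed.

Lemma poly_opE (p : {poly R}) A : poly_op p A = cpoly_op (map_poly (real_complex R) p) A.
Proof.
apply: funext => x; rewrite /poly_op /cpoly_op size_map_poly.
by apply: eq_bigr => i _; rewrite coef_map.
Qed.

Lemma poly_op_bounded p A : bounded_op A -> bounded_op (poly_op p A).
Proof. by rewrite poly_opE; apply: cpoly_op_bounded. Qed.

Lemma poly_opD p q A x : poly_op (p + q) A x = poly_op p A x + poly_op q A x.
Proof. by rewrite !poly_opE rmorphD cpoly_opD. Qed.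

Lemma poly_opN p A x : poly_op (- p) A x = - poly_op p A x.
Proof. by rewrite !poly_opE rmorphN -scaleN1r cpoly_opZ scaleN1r. Qed.

Lemma poly_opB p q A x : poly_op (p - q) A x = poly_op p A x - poly_op q A x.
Proof. by rewrite poly_opD poly_opN. Qed.

Lemma poly_opM p q A x : linear A ->
  poly_op (p * q) A x = poly_op p A (poly_op q A x).
Proof. by move=> lA; rewrite !poly_opE rmorphM cpoly_opM. Qed.

Lemma poly_opX A x : poly_op 'X A x = A x.
Proof.
by rewrite poly_opE map_polyX -['X]mul1r cpoly_opMX -[1]/(1%:P) cpoly_opC scale1r.
Qed.

Lemma poly_opC (c : R) A x : poly_op c%:P A x = c%:C *: x.
Proof. by rewrite poly_opE map_polyC cpoly_opC. Qed.

Lemma poly_op_selfadjoint p A :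
  linear A -> selfadjoint A -> selfadjoint (poly_op p A).
Proof.
move=> lA sA; rewrite poly_opE; elim/poly_ind: p => [|p c IH] x y.
  by rewrite rmorph0 -[0]/(0%:P) !cpoly_opC !scale0r rinner0l rinner0r.
rewrite rmorphD rmorphM /= map_polyX map_polyC /= !cpoly_opD !cpoly_opMX !cpoly_opC.
rewrite !rinnerE; congr (_ + _).
by rewrite IH sA cpoly_op_comm.
Qed.

Lemma cpoly_op_bounded_below (rs : seq R[i]) (c : R[i]) A :
  linear A -> c != 0 ->
  (forall r, r \in rs -> bounded_below (fun x => A x - r *: x)) ->
  bounded_below (cpoly_op (c *: \prod_(r <- rs) ('X - r%:P)) A).
Proof.
move=> lA c0; elim: rs => [|r rs IH] h.
  exists (complex.Re `|c|); first by move: c0; rewrite -normr_gt0 normc_def ltcR.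
  by move=> x; rewrite big_nil cpoly_opZ -[1]/(1%:P) cpoly_opC scale1r rnormZ.
rewrite big_cons mulrC scalerAl.
have -> : cpoly_op ((c *: \prod_(j <- rs) ('X - j%:P)) * ('X - r%:P)) A =
   cpoly_op (c *: \prod_(r <- rs) ('X - r%:P)) A \o (fun x => A x - r *: x).
  apply: funext => x /=; rewrite cpoly_opM // cpoly_opD -polyCN cpoly_opC.
  by rewrite -['X]mul1r cpoly_opMX -[1]/(1%:P) cpoly_opC scale1r scaleNr.
apply: bounded_below_comp; last by apply: h; rewrite mem_head.
by apply: IH => s hs; apply: h; rewrite in_cons hs orbT.
Qed.

(** Expanding d^2 |x|^2 <= |S^2 x - nu^2 x|^2 with |S^2 x| <= nu |Sx| gives |Sx|^2 <= (nu^2 -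
    d^2/nu^2) |x|^2, so the norm of S would be smaller than nu. *)
Lemma sq_not_bounded_below S : bounded_op S -> selfadjoint S -> 0 < opnorm S ->
  ~ bounded_below (fun x => S (S x) - (opnorm S ^+ 2)%:C *: x).
Proof.
move=> bS sS; set nu := opnorm S => nu0 [d d0 hd].
have n2 : 0 < nu ^+ 2 by rewrite exprn_gt0.
have k x : nr (S x) ^+ 2 <= (nu ^+ 2 - d ^+ 2 / nu ^+ 2) * nr x ^+ 2.
  have h1 : (d * nr x) ^+ 2 <= nr (S (S x) - (nu ^+ 2)%:C *: x) ^+ 2.
    rewrite ler_sqr ?nnegrE ?rnorm_ge0 ?mulr_ge0 ?rnorm_ge0 ?(ltW d0) //; exact: hd.
  have h2 : nr (S (S x)) ^+ 2 <= nu ^+ 2 * nr (S x) ^+ 2.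
    rewrite -exprMn ler_sqr ?nnegrE ?rnorm_ge0 ?mulr_ge0 ?rnorm_ge0 ?(ltW nu0) //.
    exact: opnorm_ub.
  move: h1; rewrite rnorm_sqB rinnerZr sS -rnorm_sq rnormZr ger0_norm ?(ltW n2) // !exprMn.
  move=> h1; rewrite -(ler_pM2l n2).
  have -> : nu ^+ 2 * ((nu ^+ 2 - d ^+ 2 / nu ^+ 2) * nr x ^+ 2) =
            nu ^+ 2 ^+ 2 * nr x ^+ 2 - d ^+ 2 * nr x ^+ 2.
    by field; rewrite gt_eqF.
  lra.
pose c := nu ^+ 2 - d ^+ 2 / nu ^+ 2.
have cn : c < nu ^+ 2 by rewrite /c gtrBl divr_gt0 // exprn_gt0.
have : nu <= Num.sqrt c.
  apply: opnorm_le; first exact: sqrtr_ge0.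
  move=> x; apply: sq_le; first by rewrite mulr_ge0 ?sqrtr_ge0 ?rnorm_ge0.
  (* The constant c may be negative, in which case [Num.sqrt c] is 0 and the bound [k] forces Sx =
     0. *)
  have [c0|c0] := leP 0 c; first by rewrite exprMn sqr_sqrtr.
  apply: le_trans (k x) _; rewrite -/c.
  apply: (@le_trans _ _ 0); last exact: sqr_ge0.
  by rewrite mulr_le0_ge0 ?sqr_ge0 // ltW.
have [c0|c0] := leP 0 c; last by rewrite ltr0_sqrtr // leNgt nu0.
rewrite -ler_sqr ?nnegrE ?sqrtr_ge0 ?(ltW nu0) // sqr_sqrtr // leNgt cn //.
Qed.

(** Write r = a + ib. Because A - a is selfadjoint, |(A - r)x|^2 = |(A - a)x|^2 + b^2 |x|^2, which
    settles b != 0. For b = 0 the form of A - a is at least -a |x|^2 when a < 0, and at most (||A||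
    - a) |x|^2 when a > ||A||; Cauchy-Schwarz does the rest. *)
Lemma bounded_below_sub A (r : R[i]) : bounded_op A -> selfadjoint A ->
  (forall x, 0 <= rp (A x) x) ->
  ~ (exists2 s : R, r = s%:C & 0 <= s <= opnorm A) ->
  bounded_below (fun x => A x - r *: x).
Proof.
move=> bA sA pA; case: r => a b h; have lA := bounded_op_linear bA.
have key x : nr (A x - (a +i* b)%C *: x) ^+ 2 =
    nr (A x - a%:C *: x) ^+ 2 + b ^+ 2 * nr x ^+ 2.
  have -> : (a +i* b)%C = a%:C + b%:C * 'i%C.
    by apply/eqP; rewrite eq_complex /= !(mul0r, mulr0, mulr1, addr0, add0r, subr0) !eqxx.
  rewrite scalerDl opprD addrA -scalerA [in LHS]rnorm_sqB [in LHS]rnormZr rnormi exprMn.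
  rewrite real_normK ?num_real // rinnerZr.
  have -> : rp (A x - a%:C *: x) ('i%C *: x) = 0; last by ring.
  by rewrite rinnerBl rinnerZl selfadjoint_rinneri // -Im_inner inner_self /= mulr0 subr0.
have sufb (d : R) : 0 < d -> (forall x, (d * nr x) ^+ 2 <= nr (A x - (a +i* b)%C *: x) ^+ 2) ->
    bounded_below (fun x => A x - (a +i* b)%C *: x).
  by move=> d0 hd; exists d => // x; apply: sq_le; rewrite ?rnorm_ge0.
have low (d : R) : 0 < d -> (forall x, d * nr x ^+ 2 <= `|rp (A x - a%:C *: x) x|) ->
    bounded_below (fun x => A x - (a +i* b)%C *: x).
  move=> d0 hd; apply: (sufb d) => // x; rewrite key.
  apply: (@le_trans _ _ (nr (A x - a%:C *: x) ^+ 2)); last first.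
    by rewrite lerDl mulr_ge0 // sqr_ge0.
  have [->|x0] := eqVneq x 0; first by rewrite rnorm0 mulr0 expr0n sqr_ge0.
  have nx := rnorm_gt0 x0.
  rewrite ler_sqr ?nnegrE ?mulr_ge0 ?rnorm_ge0 ?(ltW d0) // -(ler_pM2r nx) -mulrA -expr2.
  by apply: le_trans (hd x) _; exact: rinner_norm_le.
have [b0|b0] := eqVneq b 0; last first.
  apply: (sufb `|b|); first by rewrite normr_gt0.
  by move=> x; rewrite key exprMn real_normK ?num_real // lerDr sqr_ge0.
subst b; have [a0|a0] := ltP a 0.
  apply: (low (- a)); first by rewrite oppr_gt0.
  move=> x; rewrite rinnerBl rinnerZl -rnorm_sq.
  by apply: le_trans (ler_norm _); have := pA x; lra.
have [aM|aM] := leP a (opnorm A).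
  by case: h; exists a => //; rewrite a0 aM.
apply: (low (a - opnorm A)); first by rewrite subr_gt0.
move=> x; rewrite rinnerBl rinnerZl -rnorm_sq distrC.
apply: le_trans (ler_norm _); rewrite mulrBl lerB //.
apply: le_trans (rinner_le _ _) _; rewrite expr2 mulrA ler_wpM2r ?rnorm_ge0 //.
exact: opnorm_ub.
Qed.

(* If the norm nu of p(A) exceeded c, then p^2 - nu^2 would have no root in
   [0, ||A||], so p(A)^2 - nu^2 would be a product of operators A - r that are
   bounded below; but nu^2 is an approximate eigenvalue of p(A)^2. *)
Lemma poly_op_norm A (p : {poly R}) (c : R) : bounded_op A -> selfadjoint A ->
  (forall x, 0 <= rp (A x) x) -> 0 <= c ->
  (forall s, 0 <= s <= opnorm A -> `|p.[s]| <= c) ->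
  opnorm (poly_op p A) <= c.
Proof.
move=> bA sA pA c0 hc; rewrite leNgt; apply/negP => lt.
have lA := bounded_op_linear bA.
set nu := opnorm _ in lt; have nu0 := le_lt_trans c0 lt.
apply: (sq_not_bounded_below (poly_op_bounded p bA) (poly_op_selfadjoint p lA sA) nu0).
rewrite -/nu; pose Q := p ^+ 2 - (nu ^+ 2)%:P.
pose QC := map_poly (real_complex R) Q.
have -> : (fun x => poly_op p A (poly_op p A x) - (nu ^+ 2)%:C *: x) = cpoly_op QC A.
  by apply: funext => x; rewrite -poly_opE poly_opB poly_opM // poly_opC.
have Qs s : 0 <= s <= opnorm A -> Q.[s] != 0.
  move=> hs; rewrite !hornerE subr_eq0; apply: contraTneq (hc _ hs) => e.
  rewrite -ltNge -ltr_sqr ?nnegrE // ?(ltW nu0) // real_normK ?num_real // e.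
  by rewrite ltr_sqr ?nnegrE // ltW.
have Q0 : QC != 0.
  rewrite map_poly_eq0; apply: contraTneq (Qs 0 _) => [->|]; first by rewrite horner0 eqxx.
  by rewrite lexx opnorm_ge0.
have [rs hrs] := closed_field_poly_normal QC.
rewrite hrs; apply: cpoly_op_bounded_below => //; first by rewrite lead_coef_eq0.
move=> r rrs; apply: bounded_below_sub => // -[s rE hs].
have : root QC r by rewrite hrs rootZ ?lead_coef_eq0 // root_prod_XsubC.
by rewrite rE /QC fmorph_root rootE (negbTE (Qs _ hs)).
Qed.

End PolynomialCalculus.

(** * Polynomial approximation of real powers, and their dependence on the exponent *)

Section PowerApproximation.
Context {R : realType}.
Implicit Types (s t x y M : R).

(* The Bernstein polynomial of the values [g 0, ..., g n], written as an
   iterated convex combination so that no binomial sum is needed. *)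
Fixpoint bernstein n (g : nat -> R) : {poly R} :=
  if n is m.+1 then (1 - 'X) * bernstein m g + 'X * bernstein m (g \o S)
  else (g 0%N)%:P.

(** For K binomial with parameters n and x, the value of the Bernstein polynomial is the mean of
    g(K), and the right-hand side is the mean of a + b (K - u)^2. The induction conditions on one
    trial; a success shifts the centre u to u - 1. *)
Lemma bernstein_approx n (g : nat -> R) (a b c u x : R) : 0 <= x <= 1 ->
  (forall k : nat, `|g k - c| <= a + b * (k%:R - u) ^+ 2) ->
  `|(bernstein n g).[x] - c| <= a + b * ((n%:R * x - u) ^+ 2 + n%:R * x * (1 - x)).
Proof.
move=> /andP[x0 x1]; elim: n g u => [|n IH] g u hg.
  by rewrite hornerC !mul0r addr0; exact: hg.
rewrite !hornerE.
have -> : (1 - x) * (bernstein n g).[x] + x * (bernstein n (g \o S)).[x] - c =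
    (1 - x) * ((bernstein n g).[x] - c) + x * ((bernstein n (g \o S)).[x] - c) by ring.
apply: le_trans (ler_normD _ _) _; rewrite !normrM (ger0_norm x0).
rewrite (@ger0_norm _ (1 - x)) ?subr_ge0 //.
have h1 := IH g u hg.
have h2 : `|(bernstein n (g \o S)).[x] - c| <=
    a + b * ((n%:R * x - (u - 1)) ^+ 2 + n%:R * x * (1 - x)).
  apply: IH => k /=; have := hg k.+1; rewrite -natr1.
  by have -> : k%:R + 1 - u = k%:R - (u - 1) by ring.
have := lerD (ler_wpM2l (_ : 0 <= 1 - x) h1) (ler_wpM2l x0 h2).
rewrite subr_ge0 => /(_ x1) h; apply: le_trans h _.
rewrite -natr1 le_eqVlt; apply/orP; left; apply/eqP; ring.
Qed.

(** For z = x and z = y the ratio z / (x + y) is at most 1, hence at most its t-th power; the two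
    ratios sum to 1. *)
Lemma powR_subadd x y t : 0 <= x -> 0 <= y -> 0 < t <= 1 ->
  (x + y) `^ t <= x `^ t + y `^ t.
Proof.
move=> x0 y0 /andP[t0 t1].
have [->|xn] := eqVneq x 0; first by rewrite add0r powR0 ?gt_eqF // add0r.
have [->|yn] := eqVneq y 0; first by rewrite addr0 (@powR0 _ t) ?gt_eqF // addr0.
have {}x0 : 0 < x by rewrite lt_neqAle eq_sym xn.
have {}y0 : 0 < y by rewrite lt_neqAle eq_sym yn.
have s0 : 0 < x + y by exact: addr_gt0.
have h z : 0 < z -> z <= x + y -> z / (x + y) * (x + y) `^ t <= z `^ t.
  move=> z0 zs.
  have -> : z `^ t = (z / (x + y)) `^ t * (x + y) `^ t.
    by rewrite -powRM ?divr_ge0 ?(ltW s0) ?(ltW z0) // divfK ?gt_eqF.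
  apply: ler_wpM2r; first exact: powR_ge0.
  by apply: ger1_powR => //; rewrite divr_gt0 //= ler_pdivrMr // mul1r.
have := lerD (h _ x0 _) (h _ y0 _); rewrite lerDl lerDr -mulrDl -mulrDl.
by rewrite divff ?gt_eqF // mul1r; apply; rewrite ltW.
Qed.

Lemma powR_holder x y t : 0 <= x -> 0 <= y -> 0 < t <= 1 ->
  `|x `^ t - y `^ t| <= `|x - y| `^ t.
Proof.
wlog yx : x y / y <= x => [hw|] x0 y0 ht.
  have [/hw|/ltW/hw] := leP y x; first exact.
  by rewrite distrC (distrC x); apply.
have ht' := ht; case/andP: ht' => t0 t1.
rewrite (@ger0_norm _ (x - y)) ?subr_ge0 // ger0_norm; last first.
  by rewrite subr_ge0 ge0_ler_powR ?(ltW t0).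
rewrite lerBlDr -{1}(subrK y x); apply: powR_subadd => //.
by rewrite subr_ge0.
Qed.

(** With d^t = h = e/2, the oscillation of s^t over a distance r is at most h when r <= d, and
    otherwise at most h (r/d)^t <= h (r/d)^2. The sum of the two bounds has the quadratic form that
    the Bernstein estimate asks for. *)
Lemma powR_poly_approx t M (e : R) : 0 < t <= 1 -> 0 < e ->
  exists p : {poly R}, forall s, 0 <= s <= M -> `|p.[s] - s `^ t| <= e.
Proof.
move=> ht; have /andP[t0 t1] := ht.
wlog M0 : M / 0 < M => [hw e0|].
  have M1 : 0 < `|M| + 1 by rewrite ltr_wpDl.
  have [p hp] := hw _ M1 e0; exists p => s /andP[s0 sM]; apply: hp.
  by rewrite s0 (le_trans sM) // (le_trans (ler_norm M)) // lerDl.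
move=> e0; pose h := e / 2.
have h0 : 0 < h by rewrite divr_gt0.
pose d := h `^ t^-1.
have d0 : 0 < d by exact: powR_gt0.
have dt : d `^ t = h by rewrite /d -powRrM mulVf ?gt_eqF // powRr1 // ltW.
have modulus x y : 0 <= x -> 0 <= y ->
    `|x `^ t - y `^ t| <= h + h / d ^+ 2 * (x - y) ^+ 2.
  move=> x0 y0; apply: le_trans (powR_holder x0 y0 ht) _.
  have [hd|hd] := leP `|x - y| d.
    apply: (@le_trans _ _ h).
      by rewrite -dt ge0_ler_powR // ?nnegrE ?ltW.
    by rewrite lerDl mulr_ge0 ?divr_ge0 ?sqr_ge0 // ltW.
  apply: (@le_trans _ _ (h / d ^+ 2 * (x - y) ^+ 2)); last by rewrite lerDr ltW.
  have -> : h / d ^+ 2 * (x - y) ^+ 2 = d `^ t * (`|x - y| / d) ^+ 2.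
    by rewrite dt -(real_normK (num_real (x - y))); field; rewrite gt_eqF.
  have q1 : 1 <= `|x - y| / d by rewrite ler_pdivlMr // mul1r ltW.
  have -> : `|x - y| `^ t = d `^ t * (`|x - y| / d) `^ t.
    by rewrite -powRM ?divr_ge0 ?(ltW d0) // mulrC divfK ?gt_eqF.
  apply: ler_wpM2l; first exact: powR_ge0.
  rewrite -powR_mulrn ?divr_ge0 ?(ltW d0) //; apply: ler_powR => //.
  by apply: le_trans t1 _; rewrite ler1n.
(* After the substitution s = Mx the binomial variance contributes h (Q/N) x (1 - x), so N >= Q
   keeps it below h. *)
pose Q := M ^+ 2 / d ^+ 2; pose N := (Num.bound Q).+1.
have N0 : (0 : R) < N%:R by rewrite ltr0n.
have QN : Q <= N%:R.
  have Q0 : 0 <= Q by rewrite divr_ge0 ?sqr_ge0.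
  by apply/ltW/(lt_trans (archi_boundP Q0)); rewrite ltr_nat.
pose g k := (M * (k%:R / N%:R)) `^ t.
exists (bernstein N g \Po (M^-1 *: 'X)) => s /andP[s0 sM].
rewrite horner_comp hornerZ hornerX mulrC; set x := s / M.
have x0 : 0 <= x by rewrite divr_ge0 // ltW.
have x1 : x <= 1 by rewrite ler_pdivrMr // mul1r.
have hg (k : nat) :
    `|g k - s `^ t| <= h + h * Q / N%:R ^+ 2 * (k%:R - N%:R * x) ^+ 2.
  have sE : s = M * x by rewrite mulrC divfK ?gt_eqF.
  have -> : h * Q / N%:R ^+ 2 * (k%:R - N%:R * x) ^+ 2 =
      h / d ^+ 2 * (M * (k%:R / N%:R) - s) ^+ 2.
    by rewrite sE /Q; field; rewrite !gt_eqF.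
  by apply: modulus => //; rewrite mulr_ge0 ?divr_ge0 // ltW.
have x01 : 0 <= x <= 1 by rewrite x0.
apply: le_trans (bernstein_approx N x01 hg) _.
rewrite subrr expr0n add0r.
have -> : h * Q / N%:R ^+ 2 * (N%:R * x * (1 - x)) = h * (Q / N%:R) * (x * (1 - x)).
  by field; rewrite gt_eqF.
have xx : 0 <= x * (1 - x) <= 1.
  by apply/andP; split; [rewrite mulr_ge0 // subr_ge0 | nra].
have q1 : Q / N%:R <= 1 by rewrite ler_pdivrMr // mul1r.
have q0 : 0 <= Q / N%:R by rewrite !divr_ge0 ?sqr_ge0 // ltW.
have : h * (Q / N%:R) * (x * (1 - x)) <= h * 1 * 1.
  case/andP: xx => xx0 xx1.
  apply: ler_pM => //; first by rewrite mulr_ge0 // ltW.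
  by rewrite ler_pM2l.
by rewrite !mulr1 /h => k; lra.
Qed.

(** The derivative in the exponent is s^(1+a) ln s, and the extra factor s controls the logarithm
    near 0. For s <= 1 the bounds s^(1+a) <= s and -ln s <= 1/s give the constant 1; for s >= 1 the
    bounds s^(1+b) <= s^2 and ln s <= s give M^3. *)
Lemma powR_exponent_lipschitz M s a b : 0 <= s <= M -> 0 <= a <= 1 -> 0 <= b <= 1 ->
  `|s `^ (1 + a) - s `^ (1 + b)| <= (1 + M ^+ 3) * `|a - b|.
Proof.
move=> /andP[s0 sM].
wlog ab : a b / a <= b => [hw|] /andP[a0 a1] /andP[b0 b1].
  have [/hw|/ltW/hw] := leP a b; first by apply; apply/andP.
  by rewrite distrC (distrC b); apply; apply/andP.
have M0 : 0 <= M by apply: le_trans sM.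
have M3 : 0 <= M ^+ 3 by apply: exprn_ge0.
have [->|sn] := eqVneq s 0.
  rewrite !powR0 ?subrr ?normr0 ?mulr_ge0 //; [lra|apply/eqP; lra|apply/eqP; lra].
have {sn}s0 : 0 < s by rewrite lt_neqAle eq_sym sn.
rewrite (distrC a) (@ger0_norm _ (b - a)) ?subr_ge0 //.
set k := b - a; have k0 : 0 <= k by rewrite subr_ge0.
have sP (r : R) : s `^ r = expR (r * ln s) by rewrite /powR gt_eqF.
have [s1|s1] := leP s 1.
  apply: (@le_trans _ _ k); last first.
    by rewrite -{1}(mul1r k) ler_wpM2r // lerDl.
  have sa : s `^ (1 + a) <= s by apply: ge1r_powR; [apply/andP | lra].
  have sE : s `^ (1 + b) = s `^ (1 + a) * s `^ k.
    by rewrite -powRD /k ?(gt_eqF s0) ?implybT //; congr (_ `^ _); ring.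
  have lk : 1 - s `^ k <= k * s^-1.
    have h1 : 1 - s `^ k <= - (k * ln s).
      by have := expR_ge1Dx (k * ln s); rewrite -sP; lra.
    have h2 : - ln s <= s^-1.
      have := expR_ge1Dx (- ln s); rewrite expRN lnK ?posrE // => h.
      by apply: le_trans h; rewrite lerDr.
    by apply: le_trans h1 _; rewrite -mulrN ler_wpM2l.
  have l0 : 0 <= 1 - s `^ k.
    rewrite subr_ge0; apply: le_trans (_ : s `^ 0 <= 1); last by rewrite powRr0.
    by apply: ger_powR => //; apply/andP.
  rewrite sE -{1}(mulr1 (s `^ (1 + a))) -mulrBr ger0_norm ?mulr_ge0 ?powR_ge0 //.
  apply: (@le_trans _ _ (s * (k * s^-1))).
    by apply: ler_pM => //; exact: powR_ge0.
  by rewrite mulrCA divff ?gt_eqF // mulr1.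
have {}s1 := ltW s1.
apply: (@le_trans _ _ (M ^+ 3 * k)); last by rewrite ler_wpM2r // lerDr.
have sE : s `^ (1 + a) = s `^ (1 + b) * s `^ (- k).
  by rewrite -powRD /k ?(gt_eqF s0) ?implybT //; congr (_ `^ _); ring.
have l1 : 1 - s `^ (- k) <= k * s.
  have h1 : 1 - s `^ (- k) <= k * ln s.
    by have := expR_ge1Dx (- k * ln s); rewrite -sP; lra.
  have h2 : ln s <= s.
    have := expR_ge1Dx (ln s); rewrite lnK ?posrE // => h.
    by apply: le_trans h; rewrite lerDr.
  by apply: le_trans h1 _; rewrite ler_wpM2l.
have l0 : 0 <= 1 - s `^ (- k).
  rewrite subr_ge0; apply: le_trans (_ : s `^ 0 <= 1); last by rewrite powRr0.
  by apply: ler_powR => //; lra.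
rewrite distrC sE -{1}(mulr1 (s `^ (1 + b))) -mulrBr ger0_norm ?mulr_ge0 ?powR_ge0 //.
have sb : s `^ (1 + b) <= s ^+ 2.
  by rewrite -powR_mulrn ?(ltW s0) //; apply: ler_powR => //; lra.
apply: (@le_trans _ _ (s ^+ 2 * (k * s))).
  by apply: ler_pM => //; exact: powR_ge0.
rewrite mulrCA mulrC -exprSr; apply: ler_wpM2r => //.
by apply: lerXn2r; rewrite ?nnegrE // ltW.
Qed.

End PowerApproximation.

(** * Existence of the continuous functional calculus *)

Section ContinuousCalculus.
Context {R : realType} {H : hilbertType R}.
Implicit Types (A B S : H -> H) (x y z : H).

Local Notation ip := (@inner R H).
Local Notation rp := rinner.
Local Notation nr := rnorm.
Local Notation "c %:C" := (real_complex R c).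

Lemma uniform_cvgP (D : set R) (f_ : nat -> R -> R) (f : R -> R) :
  {uniform D, f_ @ \oo --> f} <->
  forall e : R, 0 < e -> exists N, forall n, (N <= n)%N ->
    forall s, D s -> `|f s - f_ n s| < e.
Proof.
split=> [cf e e0|h P /uniform_nbhs [E [entE subP]]].
  have : nbhs (f : {uniform` D -> R}) [set g | forall s : R, D s -> `|f s - g s| < e].
    apply/uniform_nbhs; exists [set xy | ball xy.1 e xy.2]; split.
      exact: entourage_ball (PosNum e0).
    by move=> g hg s Ds; exact: (hg s Ds).
  by move/cf => [N _ hN]; exists N => n /hN.
have [e /= e0 he] : exists2 e : R, 0 < e & forall s t : R, ball s e t -> E (s, t).
  move: entE; rewrite -entourage_ballE => -[e /= e0 he]; exists e => // s t st.
  exact: (he (s, t)).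
have [N hN] := h e e0.
exists N => // n /= Nn; apply: subP => s Ds; apply: he.
by rewrite -ball_normE /=; apply: hN.
Qed.

Definition poly_approximable (M : R) (f : R -> R) :=
  forall e : R, 0 < e -> exists p : {poly R},
    forall s, 0 <= s <= M -> `|p.[s] - f s| <= e.

(** The relation B = f(A) with one polynomial per tolerance in place of a sequence; a single
    polynomial witnesses both approximations, which is what sums, products and uniqueness need. *)
Definition op_calculus (f : R -> R) A B :=
  bounded_op B /\ forall e : R, 0 < e -> exists p : {poly R},
    (forall s, 0 <= s <= opnorm A -> `|p.[s] - f s| <= e) /\
    forall x, nr (poly_op p A x - B x) <= e * nr x.

Lemma func_calc_sound f A : bounded_op A ->
  forall B, (bounded_op B /\
       exists p : nat -> {poly R},
         {uniform `[0, opnorm A], (fun n s => (p n).[s]) @ \oo --> f} /\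
         opnorm (poly_op (p n) A \- B) @[n --> \oo] --> (0 : R)) ->
  op_calculus f A B.
Proof.
move=> bA B [bB [p [/uniform_cvgP hu /cvgrPdist_lt ho]]]; split=> // e e0.
have [N1 hN1] := hu _ e0; have [N2 _ hN2] := ho _ e0.
pose n := maxn N1 N2; exists (p n); split.
  move=> s hs; rewrite distrC; apply: ltW; apply: hN1; first exact: leq_maxl.
  by rewrite /= in_itv.
move=> x; apply: le_trans (_ : opnorm (poly_op (p n) A \- B) * nr x <= _).
  by apply: (@opnorm_ub _ _ (_ \- _)); apply: bounded_op_sub => //; exact: poly_op_bounded.
apply: ler_wpM2r; first exact: rnorm_ge0.
have := hN2 n (leq_maxr _ _); rewrite /= sub0r normrN ger0_norm ?opnorm_ge0 //.
exact: ltW.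
Qed.

(** Polynomials within 1/(n+1) of f on [0, ||A||] give operators that are Cauchy in norm, by
    [poly_op_norm]. B is their pointwise limit, and the rate [lim], uniform in x, makes it linear,
    bounded and a norm limit. *)
Lemma func_calc_exists f A : bounded_op A -> selfadjoint A ->
  (forall x, 0 <= rp (A x) x) -> poly_approximable (opnorm A) f ->
  exists B, bounded_op B /\
       exists p : nat -> {poly R},
         {uniform `[0, opnorm A], (fun n s => (p n).[s]) @ \oo --> f} /\
         opnorm (poly_op (p n) A \- B) @[n --> \oo] --> (0 : R).
Proof.
move=> bA sA pA hf.
have hq (n : nat) : exists q : {poly R}, forall s : R, 0 <= s <= opnorm A ->
    `|q.[s] - f s| <= n.+1%:R^-1.
  by apply: hf; rewrite invr_gt0.
have [p hp] := choice hq.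
have cau m n x : nr (poly_op (p m) A x - poly_op (p n) A x) <=
    (m.+1%:R^-1 + n.+1%:R^-1) * nr x.
  rewrite -poly_opB; have bp := poly_op_bounded (p m - p n) bA.
  apply: le_trans (opnorm_ub _ bp) _; apply: ler_wpM2r; first exact: rnorm_ge0.
  apply: poly_op_norm => //.
  move=> s hs; rewrite hornerD hornerN.
  have -> : (p m).[s] - (p n).[s] = ((p m).[s] - f s) - ((p n).[s] - f s) by ring.
  by apply: le_trans (ler_normB _ _) _; apply: lerD; apply: hp.
have hl x : exists l, forall e : R, 0 < e ->
    exists N, forall n, (N <= n)%N -> nr (poly_op (p n) A x - l) < e.
  apply: rnorm_complete => e e0.
  have c0 : 0 < 2 * nr x + 1 by rewrite ltr_wpDl ?mulr_ge0 ?rnorm_ge0.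
  have [N hN] := invS_small (divr_gt0 e0 c0).
  exists N => m n /hN hm /hN hn; apply: le_lt_trans (cau _ _ _) _.
  apply: (@le_lt_trans _ _ ((e / (2 * nr x + 1) + e / (2 * nr x + 1)) * nr x)).
    by apply: ler_wpM2r; [exact: rnorm_ge0 | apply/ltW/ltrD].
  have -> : (e / (2 * nr x + 1) + e / (2 * nr x + 1)) * nr x =
      e - e / (2 * nr x + 1) by field; rewrite gt_eqF.
  by rewrite gtrBl divr_gt0.
have [B hB] := choice hl.
have lim n x : nr (poly_op (p n) A x - B x) <= n.+1%:R^-1 * nr x.
  rewrite -subr_le0; apply: (@le0_eps _ _ (nr x + 1)).
    by rewrite addr_ge0 ?rnorm_ge0.
  move=> e e0 _; have [N1 hN1] := hB x _ e0; have [N2 hN2] := invS_small e0.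
  pose m := maxn N1 N2.
  have := hN1 m (leq_maxl _ _); have := hN2 m (leq_maxr _ _) => h2 h1.
  have h3 := cau n m x.
  have h4 := rnormD (poly_op (p n) A x - poly_op (p m) A x) (poly_op (p m) A x - B x).
  rewrite subrKA in h4.
  have h5 : m.+1%:R^-1 * nr x <= e * nr x.
    by apply: ler_wpM2r; [exact: rnorm_ge0 | exact: ltW].
  rewrite mulrDl in h3; rewrite mulrDr mulr1.
  move: (m.+1%:R^-1 * nr x) (n.+1%:R^-1 * nr x) h3 h5 => u v h3 h5; lra.
have lB : linear B.
  move=> a x y; apply/eqP; rewrite -subr_eq0; apply/eqP/rnorm_eq0/eqP.
  rewrite eq_le rnorm_ge0 andbT.
  apply: (@le0_eps _ _ (nr (a *: x + y) + complex.Re `|a| * nr x + nr y)).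
    by rewrite !addr_ge0 ?mulr_ge0 ?rnorm_ge0 ?normc_ge0.
  move=> e e0 _; have [n /(_ n (leqnn n)) hn] := invS_small e0.
  have lp := bounded_op_linear (poly_op_bounded (p n) bA).
  have -> : B (a *: x + y) - (a *: B x + B y) =
      - (poly_op (p n) A (a *: x + y) - B (a *: x + y)) +
      (a *: (poly_op (p n) A x - B x) + (poly_op (p n) A y - B y)).
    by rewrite lp scalerBr opprB [X in _ = _ + X]addrACA -opprD subrKA.
  apply: le_trans (rnormD _ _) _; rewrite -addrA mulrDr; apply: lerD.
    by rewrite rnormN; apply: le_trans (lim n _) _; rewrite ler_wpM2r ?rnorm_ge0 ?ltW.
  apply: le_trans (rnormD _ _) _; rewrite mulrDr; apply: lerD.
    rewrite rnormZ mulrCA; apply: ler_wpM2l; first exact: normc_ge0.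
    by apply: le_trans (lim n _) _; rewrite ler_wpM2r ?rnorm_ge0 ?ltW.
  by apply: le_trans (lim n _) _; rewrite ler_wpM2r ?rnorm_ge0 ?ltW.
have bB : bounded_op B.
  apply: (@bounded_op_of _ _ _ (opnorm (poly_op (p 0%N) A) + 1)) => // x.
  have h1 := opnorm_ub x (poly_op_bounded (p 0%N) bA).
  have h2 := lim 0%N x; rewrite invr1 mul1r rnormBC in h2.
  by have := rnorm_dist (B x) (poly_op (p 0%N) A x); lra.
exists B; split => //; exists p; split.
  apply/uniform_cvgP => e e0; have [N hN] := invS_small e0.
  exists N => n /hN hn s; rewrite /= in_itv /= => hs.
  by rewrite distrC; apply: le_lt_trans hn; exact: hp.
apply/cvgrPdist_lt => e e0; have [N hN] := invS_small e0.
exists N => // n /= /hN hn; rewrite sub0r normrN ger0_norm ?opnorm_ge0 //.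
by apply: le_lt_trans hn; apply: opnorm_le => // x; exact: lim.
Qed.

Lemma func_calcP f A : bounded_op A -> selfadjoint A ->
  (forall x, 0 <= rp (A x) x) -> poly_approximable (opnorm A) f ->
  op_calculus f A (func_calc f A).
Proof.
move=> bA sA pA hf; have [B hB] := func_calc_exists bA sA pA hf.
rewrite /func_calc; case: xgetP => [B' _ /(func_calc_sound bA) //|/(_ B)].
by case.
Qed.

End ContinuousCalculus.

(** * Algebra of the functional calculus, powers and the square root *)

Section CalculusProperties.
Context {R : realType} {H : hilbertType R}.
Implicit Types (B C : H -> H) (x y z : H) (f g : R -> R).

Local Notation rp := rinner.
Local Notation nr := rnorm.
Local Notation "c %:C" := (real_complex R c).

Variables (A : H -> H) (bA : bounded_op A) (sA : selfadjoint A).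
Hypothesis pA : forall x, 0 <= rp (A x) x.

Lemma op_calculus_norm f B (c : R) : op_calculus f A B ->
  (forall s, 0 <= s <= opnorm A -> `|f s| <= c) -> opnorm B <= c.
Proof.
move=> [bB hB] hc.
have c0 : 0 <= c.
  by apply: le_trans (hc 0 _); rewrite ?normr_ge0 // lexx opnorm_ge0.
apply: opnorm_le => // x; rewrite -subr_le0.
apply: (@le0_eps _ _ (2 * nr x)); first by rewrite mulr_ge0 ?rnorm_ge0.
move=> e e0 _; have [p [hp hx]] := hB e e0.
have h1 : opnorm (poly_op p A) <= c + e.
  apply: poly_op_norm => //; first by rewrite addr_ge0 // ltW.
  move=> s hs; rewrite -(subrK (f s) p.[s]) addrC.
  by apply: le_trans (ler_normD _ _) _; rewrite lerD ?hc ?hp.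
have h2 := le_trans (opnorm_ub x (poly_op_bounded p bA)) (ler_wpM2r (rnorm_ge0 x) h1).
have h3 := rnorm_dist (B x) (poly_op p A x).
have h4 := hx x; rewrite rnormBC in h4.
lra.
Qed.

Lemma op_calculus_ext f g B : op_calculus f A B ->
  (forall s, 0 <= s <= opnorm A -> f s = g s) -> op_calculus g A B.
Proof.
move=> [bB hB] fg; split=> // e e0; have [p [hp hx]] := hB e e0.
by exists p; split=> // s hs; rewrite -fg // hp.
Qed.

Lemma op_calculus_sub f g B C : op_calculus f A B -> op_calculus g A C ->
  op_calculus (fun s => f s - g s) A (B \- C).
Proof.
move=> [bB hB] [bC hC]; split; first exact: bounded_op_sub.
move=> e e0; have e20 : 0 < e / 2 by rewrite divr_gt0.
have [p [hp hx]] := hB _ e20; have [q [hq hy]] := hC _ e20.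
exists (p - q); split=> [s hs|x].
  rewrite hornerD hornerN.
  have -> : p.[s] - q.[s] - (f s - g s) = (p.[s] - f s) - (q.[s] - g s) by ring.
  apply: le_trans (ler_normB _ _) _.
  by rewrite [leRHS]splitr lerD ?hp ?hq.
rewrite poly_opB /=.
have -> : poly_op p A x - poly_op q A x - (B x - C x) =
   (poly_op p A x - B x) - (poly_op q A x - C x).
  by rewrite !opprB addrACA [RHS]addrACA; congr (_ + _); exact: addrC.
apply: le_trans (rnormB _ _) _.
by rewrite [in leRHS](splitr e) mulrDl lerD ?hx ?hy.
Qed.

(** Turns an identity between powers on [0, ||A||] into an identity between operators; mostly used
    with g the identity and C = A. *)
Lemma op_calculus_unique f g B C : op_calculus f A B -> op_calculus g A C ->
  (forall s, 0 <= s <= opnorm A -> f s = g s) -> B = C.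
Proof.
move=> hB hC fg; have hD := op_calculus_sub hB hC.
have h : opnorm (B \- C) <= 0.
  by apply: (op_calculus_norm hD) => s /fg ->; rewrite subrr normr0.
apply: funext => x; apply: subr0_eq; apply: rnorm_eq0; apply/eqP.
rewrite eq_le rnorm_ge0 andbT.
have [bD _] := hD; apply: le_trans (opnorm_ub x bD) _.
by rewrite mulr_le0_ge0 ?rnorm_ge0.
Qed.

Lemma op_calculus_mul f g B C (cf cg : R) :
  (forall s, 0 <= s <= opnorm A -> `|f s| <= cf) ->
  (forall s, 0 <= s <= opnorm A -> `|g s| <= cg) ->
  op_calculus f A B -> op_calculus g A C ->
  op_calculus (fun s => f s * g s) A (B \o C).
Proof.
move=> hcf hcg [bB hB] [bC hC]; split; first exact: bounded_op_comp.
have h00 : 0 <= (0 : R) <= opnorm A by rewrite lexx opnorm_ge0.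
have cf0 : 0 <= cf by apply: le_trans (hcf 0 h00).
have cg0 : 0 <= cg by apply: le_trans (hcg 0 h00).
move=> e e0; pose K := cf + cg + 1 + opnorm B + opnorm C.
have K0 : 0 < K.
  by rewrite /K; have := opnorm_ge0 B; have := opnorm_ge0 C; lra.
(* K dominates the coefficients of d in both error estimates once d <= 1; this choice gives d <= 1
   and d * K <= e together. *)
pose d := e / (e + K); have d0 : 0 < d by rewrite divr_gt0 // addr_gt0.
have eK : 0 < e + K by exact: addr_gt0.
have d1 : d <= 1 by rewrite /d ler_pdivrMr // mul1r lerDl ltW.
have dK : d * K <= e.
  rewrite /d mulrAC ler_pdivrMr //.
  by apply: ler_wpM2l; rewrite ?ltW // ltrDr.
have [p [hp hx]] := hB _ d0; have [q [hq hy]] := hC _ d0.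
exists (p * q); split=> [s hs|x].
  rewrite hornerM.
  have -> : p.[s] * q.[s] - f s * g s =
    (p.[s] - f s) * (q.[s] - g s) + (p.[s] - f s) * g s + f s * (q.[s] - g s) by ring.
  apply: le_trans (ler_normD _ _) _.
  apply: (@le_trans _ _ (d * 1 + d * cg + cf * d)).
    apply: lerD; last by rewrite normrM; apply: ler_pM => //; [exact: hcf|exact: hq].
    apply: le_trans (ler_normD _ _) _; apply: lerD.
      rewrite normrM; apply: ler_pM => //; first exact: hp.
      exact: le_trans (hq s hs) d1.
    by rewrite normrM; apply: ler_pM => //; [exact: hp|exact: hcg].
  apply: le_trans dK; rewrite /K.
  have := mulr_ge0 (ltW d0) (opnorm_ge0 B); have := mulr_ge0 (ltW d0) (opnorm_ge0 C).
  lra.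
rewrite poly_opM; last exact: bounded_op_linear.
have -> : poly_op p A (poly_op q A x) - (B \o C) x =
    (poly_op p A (poly_op q A x) - B (poly_op q A x)) + B (poly_op q A x - C x).
  by rewrite (linopB (bounded_op_linear bB)) subrKA.
apply: le_trans (rnormD _ _) _.
have h1 := hx (poly_op q A x).
have h2 := opnorm_ub (poly_op q A x - C x) bB.
have h3 := ler_wpM2l (opnorm_ge0 B) (hy x).
have h4 := rnorm_dist (poly_op q A x) (C x).
have h5 := opnorm_ub x bC; have h6 := hy x.
have nx := rnorm_ge0 x.
have h7 : d * nr x <= nr x by rewrite -{2}(mul1r (nr x)) ler_wpM2r.
have h8 : d * nr (poly_op q A x) <= d * (opnorm C * nr x + nr x).
  by apply: ler_wpM2l; [exact: ltW | lra].
have h9 : d * K * nr x <= e * nr x by apply: ler_wpM2r.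
have h10 := mulr_ge0 (mulr_ge0 (ltW d0) nx) cf0.
have h11 := mulr_ge0 (mulr_ge0 (ltW d0) nx) cg0.
rewrite /K in h9; lra.
Qed.

Lemma op_calculusX : op_calculus id A A.
Proof.
split=> // e e0; exists 'X; split=> [s _|x].
  by rewrite hornerX subrr normr0 ltW.
by rewrite poly_opX subrr rnorm0 mulr_ge0 ?rnorm_ge0 // ltW.
Qed.

Lemma op_calculus_selfadjoint f B : op_calculus f A B -> selfadjoint B.
Proof.
move=> [bB hB] x y; apply/eqP; rewrite -subr_eq0 -normr_eq0 eq_le normr_ge0 andbT.
apply: (@le0_eps _ _ (2 * (nr x * nr y))).
  by rewrite !mulr_ge0 ?rnorm_ge0.
move=> e e0 _; have [p [_ hx]] := hB e e0.
have sp := poly_op_selfadjoint p (bounded_op_linear bA) sA x y.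
have -> : rp (B x) y - rp x (B y) =
   rp x (poly_op p A y - B y) - rp (poly_op p A x - B x) y.
  by rewrite rinnerBl rinnerBr sp; ring.
have h1 := le_trans (rinner_norm_le x (poly_op p A y - B y))
   (ler_wpM2l (rnorm_ge0 x) (hx y)).
have h2 := le_trans (rinner_norm_le (poly_op p A x - B x) y)
   (ler_wpM2r (rnorm_ge0 y) (hx x)).
apply: le_trans (ler_normB _ _) _; lra.
Qed.

Lemma poly_op_ker p x : A x = 0 -> poly_op p A x = (p.[0])%:C *: x.
Proof.
move=> Ax; elim/poly_ind: p => [|p c IH].
  by rewrite horner0 -(poly_opC 0 A).
have lA := bounded_op_linear bA.
rewrite poly_opD poly_opM // poly_opX Ax poly_opC.
rewrite linop0 ?add0r ?hornerMXaddC ?mulr0 ?add0r //.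
exact: bounded_op_linear (poly_op_bounded p bA).
Qed.

(** On the kernel of A a polynomial p(A) acts as the scalar p(0), which is close to f(0). *)
Lemma op_calculus_ker f B x : op_calculus f A B -> f 0 = 0 -> A x = 0 -> B x = 0.
Proof.
move=> [bB hB] f0 Ax; apply: rnorm_eq0; apply/eqP; rewrite eq_le rnorm_ge0 andbT.
apply: (@le0_eps _ _ (2 * nr x)); first by rewrite mulr_ge0 ?rnorm_ge0.
move=> e e0 _; have [p [hp hx]] := hB e e0.
have := hx x; rewrite (poly_op_ker p Ax) rnormBC => h.
have := hp 0; rewrite lexx opnorm_ge0 f0 subr0 => /(_ isT) h0.
have := rnorm_dist (B x) ((p.[0])%:C *: x); rewrite rnormZr => h1.
have := ler_wpM2r (rnorm_ge0 x) h0; lra.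
Qed.

Lemma func_calc_powR t : 0 < t <= 1 ->
  op_calculus (fun s => s `^ t) A (func_calc (fun s => s `^ t) A).
Proof. by move=> ht; apply: func_calcP => // e; apply: powR_poly_approx. Qed.

Lemma powR_op_bound t s : 0 < t -> 0 <= s <= opnorm A -> `|s `^ t| <= opnorm A `^ t.
Proof.
move=> t0 /andP[s0 sM]; rewrite ger0_norm ?powR_ge0 //.
by apply: ge0_ler_powR; rewrite ?nnegrE ?(ltW t0) // (le_trans s0).
Qed.

Lemma func_calc_powRD a b : 0 < a -> 0 < b -> a + b <= 1 ->
  op_calculus (fun s => s `^ (a + b)) A
    (func_calc (fun s => s `^ a) A \o func_calc (fun s => s `^ b) A).
Proof.
move=> a0 b0 ab.
have [a1 b1] : 0 < a <= 1 /\ 0 < b <= 1 by split; apply/andP; split => //; lra.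
have -> : (fun s : R => s `^ (a + b)) = (fun s => s `^ a * s `^ b).
  by apply: funext => s; rewrite powRD // gt_eqF // addr_gt0.
apply: op_calculus_mul (func_calc_powR a1) (func_calc_powR b1) => s.
  exact: powR_op_bound.
exact: powR_op_bound.
Qed.

Lemma func_calc_powR_compl t : 0 < t < 1 ->
  func_calc (fun s => s `^ (1 - t)) A \o func_calc (fun s => s `^ t) A = A.
Proof.
move=> /andP[t0 t1].
have h := @func_calc_powRD (1 - t) t _ t0 _.
rewrite subrK in h; have {}h := h _ _.
apply: (op_calculus_unique (h _ _) op_calculusX); rewrite ?subr_gt0 //.
by move=> s /andP[s0 _]; rewrite powRr1.
Qed.

Lemma func_calc_powR1 : func_calc (fun s => s `^ 1) A = A.
Proof.
have h : 0 < (1 : R) <= 1 by rewrite ltr01 lexx.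
apply: (op_calculus_unique (func_calc_powR h) op_calculusX).
by move=> s /andP[s0 _]; rewrite powRr1.
Qed.

(** The square root is built as the square of the fourth root Q, so that its positivity is <Q^2 x,
    x> = |Qx|^2. *)
Lemma func_calc_sqrt_exists :
  exists P : H -> H, [/\ bounded_op P, selfadjoint P, (forall x, 0 <= rp (P x) x) & P \o P = A].
Proof.
pose Q := func_calc (fun s => s `^ 4^-1) A.
have h4 : (0 : R) < 4^-1 by rewrite invr_gt0.
have h4' : 0 < (4^-1 : R) <= 1 by apply/andP; split => //; lra.
have hQ : op_calculus (fun s => s `^ 4^-1) A Q by exact: func_calc_powR.
have sQ := op_calculus_selfadjoint hQ.
have hP := @func_calc_powRD 4^-1 4^-1 h4 h4 ltac:(lra).
have b2 s : 0 <= s <= opnorm A -> `|s `^ (4^-1 + 4^-1)| <= opnorm A `^ (4^-1 + 4^-1).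
  by apply: powR_op_bound; rewrite addr_gt0.
exists (Q \o Q); split.
- by case: hP.
- by move=> x y /=; rewrite !sQ.
- by move=> x /=; rewrite sQ rinner_ge0.
- apply: (op_calculus_unique (op_calculus_mul b2 b2 hP hP) op_calculusX) => s /andP[s0 _].
  rewrite -powRD; last by rewrite gt_eqF // !addr_gt0.
  by have -> : 4^-1 + 4^-1 + (4^-1 + 4^-1) = 1 :> R; [field | rewrite powRr1].
Qed.

End CalculusProperties.

(** * The numerical radius inequality for a factorization of T^2 *)

Section NumericalRadius.
Context {R : realType} {H : hilbertType R}.
Implicit Types (T X Y Z : H -> H) (x y z : H).

Local Notation ip := (@inner R H).
Local Notation rp := rinner.
Local Notation nr := rnorm.
Local Notation "c %:C" := (real_complex R c).

Lemma rinner_le_inner x y : `|rp x y| <= complex.Re `|ip x y|.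
Proof. by have := normc_ge_Re (ip x y); rewrite normc_def lecR. Qed.

(** Z^2 - nu^2 = (Z - nu)(Z + nu). *)
Lemma bounded_below_sq Z (nu : R) : linear Z ->
  (forall l : R, `|l| = `|nu| -> bounded_below (fun x => Z x - l%:C *: x)) ->
  bounded_below (fun x => Z (Z x) - (nu ^+ 2)%:C *: x).
Proof.
move=> lZ h.
have -> : (fun x => Z (Z x) - (nu ^+ 2)%:C *: x) =
    (fun x => Z x - nu%:C *: x) \o (fun x => Z x - (- nu)%:C *: x).
  apply: funext => x /=; rewrite rmorphN rmorphXn /= scaleNr opprK.
  rewrite (linopD lZ) (linopZ lZ) scalerDr opprD scalerA -expr2 addrA.
  by congr (_ - _); rewrite -addrA subrr addr0.
by apply: bounded_below_comp; apply: h => //; rewrite normrN.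
Qed.

(* Write Z = XY + Y*X*, u = Yx, v = X*x.  If Zx is close to lx, then
   l(a^2|u|^2 + b^2|v|^2) is close to a^2 <YZx, u> + b^2 <X*Zx, v>; the weights
   a = ||X||, b = ||Y|| make the cross terms <YY*v, u> and <X*Xu, v>
   contribute at most ab. *)
Lemma swap_bounded_below X Y (w l : R) : bounded_op X -> bounded_op Y ->
  (forall x, `|rp (Y (X x)) x| <= w * nr x ^+ 2) -> 0 <= w ->
  w + opnorm X * opnorm Y < `|l| ->
  bounded_below (fun x => X (Y x) + adjoint Y (adjoint X x) - l%:C *: x).
Proof.
move=> bX bY hw w0; set a := opnorm X; set b := opnorm Y; set nu := `|l| => kn.
have a0 : 0 <= a by exact: opnorm_ge0.
have b0 : 0 <= b by exact: opnorm_ge0.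
have ab0 : 0 <= a * b by exact: mulr_ge0.
pose D := nu - (w + a * b); have D0 : 0 < D by rewrite subr_gt0.
have nu0 : 0 < nu by rewrite (le_lt_trans _ kn) // addr_ge0.
pose c := (a * b) ^+ 2; have c0 : 0 <= c by exact: sqr_ge0.
(* Two smallness conditions are needed, one from each summand of the denominator: 2d <= nu absorbs
   the error E into nu |x|, and 16 c d < D nu^2 yields the final contradiction. *)
pose d := D * nu ^+ 2 / (16 * (c + 1) + 2 * D * nu).
have den0 : 0 < 16 * (c + 1) + 2 * D * nu.
  by rewrite addr_gt0 ?mulr_gt0 // ltr_wpDl.
have d0 : 0 < d by rewrite divr_gt0 // mulr_gt0 // exprn_gt0.
have dden : d * (16 * (c + 1) + 2 * D * nu) = D * nu ^+ 2.
  by rewrite /d divfK // gt_eqF.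
have Dnu0 : 0 < D * nu by exact: mulr_gt0.
have d1 : 2 * d <= nu.
  rewrite -(ler_pM2l Dnu0) -[leRHS]mulrA -[nu * nu]expr2 -dden mulrDr.
  have -> : D * nu * (2 * d) = d * (2 * D * nu) by ring.
  by rewrite lerDr mulr_ge0 ?(ltW d0) // mulr_ge0 // addr_ge0.
have d2 : 16 * (c * d) < D * nu ^+ 2.
  rewrite -dden mulrDr mulrDr mulrDr mulr1.
  have h1 : 0 < d * 16 by rewrite mulr_gt0.
  have h2 : 0 < d * (2 * D * nu) by rewrite mulr_gt0 // -mulrA mulr_gt0.
  have -> : 16 * (c * d) = d * (16 * c) by ring.
  lra.
exists d => // x; rewrite leNgt; apply/negP => he.
set e := _ - _ in he; set E := nr e in he.
set u := Y x; set v := adjoint X x.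
have lX := bounded_op_linear bX; have lY := bounded_op_linear bY.
have bXs := adjoint_bounded bX; have bYs := adjoint_bounded bY.
have lXs := bounded_op_linear bXs; have lYs := bounded_op_linear bYs.
have nx0 := rnorm_ge0 x; have E0 : 0 <= E by exact: rnorm_ge0.
have nx : 0 < nr x.
  rewrite lt_neqAle nx0 andbT; apply/eqP => nx.
  by move: he; rewrite -nx mulr0 ltNge E0.
have lx : l%:C *: x = X u + adjoint Y v - e by rewrite /e opprB addrC subrK.
have nu1 : nr u <= b * nr x by exact: opnorm_ub.
have nv1 : nr v <= a * nr x by exact: adjoint_bound.
have u0 := rnorm_ge0 u; have v0 := rnorm_ge0 v.
pose Q := a ^+ 2 * nr u ^+ 2 + b ^+ 2 * nr v ^+ 2.
have eu : l * nr u ^+ 2 = rp (Y (X u)) u + rp (adjoint Y v) (adjoint Y u) - rp (Y e) u.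
  rewrite rnorm_sq -rinnerZl -[in LHS]/u {1}/u -(linopZ lY) lx linopB // linopD //.
  by rewrite rinnerBl rinnerDl (@adjoint_rinner _ _ Y (adjoint Y v)).
have ev : l * nr v ^+ 2 = rp (X u) (X v) + rp v (Y (X v)) - rp (adjoint X e) v.
  rewrite rnorm_sq -rinnerZl {1}/v -(linopZ lXs) lx linopB // linopD //.
  rewrite rinnerBl rinnerDl; congr (_ + _ - _).
    by rewrite rinnerC -adjoint_rinner // rinnerC.
  rewrite rinnerC -adjoint_rinner // -adjoint_rinner // rinnerC //.
have h1 := hw u.
have h2 : `|rp v (Y (X v))| <= w * nr v ^+ 2 by rewrite rinnerC.
have h3 : `|rp (adjoint Y v) (adjoint Y u)| <= b ^+ 2 * (nr u * nr v).
  apply: le_trans (rinner_norm_le _ _) _.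
  have -> : b ^+ 2 * (nr u * nr v) = (b * nr v) * (b * nr u) by ring.
  by apply: ler_pM; rewrite ?rnorm_ge0 ?adjoint_bound.
have h4 : `|rp (X u) (X v)| <= a ^+ 2 * (nr u * nr v).
  apply: le_trans (rinner_norm_le _ _) _.
  have -> : a ^+ 2 * (nr u * nr v) = (a * nr u) * (a * nr v) by ring.
  by apply: ler_pM; rewrite ?rnorm_ge0 ?opnorm_ub.
have h5 : `|rp (Y e) u| <= b ^+ 2 * (E * nr x).
  apply: le_trans (rinner_norm_le _ _) _.
  have -> : b ^+ 2 * (E * nr x) = (b * E) * (b * nr x) by ring.
  by apply: ler_pM; rewrite ?rnorm_ge0 ?opnorm_ub.
have h6 : `|rp (adjoint X e) v| <= a ^+ 2 * (E * nr x).
  apply: le_trans (rinner_norm_le _ _) _.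
  have -> : a ^+ 2 * (E * nr x) = (a * E) * (a * nr x) by ring.
  by apply: ler_pM; rewrite ?rnorm_ge0 ?adjoint_bound.
have hu : nu * nr u ^+ 2 <= w * nr u ^+ 2 + b ^+ 2 * (nr u * nr v) + b ^+ 2 * (E * nr x).
  rewrite -(ger0_norm (sqr_ge0 (nr u))) -normrM eu.
  apply: le_trans (ler_normB _ _) _; apply: lerD => //.
  apply: le_trans (ler_normD _ _) _; apply: lerD => //.
  by rewrite ger0_norm ?sqr_ge0.
have hv : nu * nr v ^+ 2 <= w * nr v ^+ 2 + a ^+ 2 * (nr u * nr v) + a ^+ 2 * (E * nr x).
  rewrite -(ger0_norm (sqr_ge0 (nr v))) -normrM ev.
  apply: le_trans (ler_normB _ _) _; apply: lerD => //.
  apply: le_trans (ler_normD _ _) _; rewrite addrC; apply: lerD => //.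
  by rewrite ger0_norm ?sqr_ge0.
(* In a^2 [hu] + b^2 [hv] the cross terms add up to 2 a^2 b^2 |u||v|, which is at most ab Q because
   ab (a|u| - b|v|)^2 >= 0. *)
have hQ : D * Q <= 2 * c * (E * nr x).
  have g1 := ler_wpM2l (sqr_ge0 a) hu; have g2 := ler_wpM2l (sqr_ge0 b) hv.
  have g3 := mulr_ge0 ab0 (sqr_ge0 (a * nr u - b * nr v)).
  by rewrite /D /Q /c; lra.
(* A lower bound for Q is needed as well: reconstructing lx from u, v and e shows that u and v
   cannot both be small, which leads to (nu |x|)^2 <= 8 Q. *)
have hx : nu * nr x <= a * nr u + b * nr v + E.
  have -> : nu * nr x = nr (l%:C *: x) by rewrite rnormZr.
  rewrite lx; apply: le_trans (rnormB _ _) _; rewrite lerD2r.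
  apply: le_trans (rnormD _ _) _.
  by apply: lerD; [exact: opnorm_ub | exact: adjoint_bound].
have hs : (a * nr u + b * nr v) ^+ 2 <= 2 * Q.
  have := sqr_ge0 (a * nr u - b * nr v); rewrite /Q => g; lra.
have half : nu * nr x <= 2 * (a * nr u + b * nr v).
  have := ler_wpM2r nx0 d1; lra.
have q4 : (nu * nr x) ^+ 2 <= 8 * Q.
  apply: le_trans (_ : (2 * (a * nr u + b * nr v)) ^+ 2 <= _).
    rewrite ler_sqr // nnegrE ?mulr_ge0 ?addr_ge0 ?mulr_ge0 // ltW //.
  by rewrite exprMn; lra.
have f1 : D * (nu * nr x) ^+ 2 <= 16 * c * (d * nr x * nr x).
  apply: (@le_trans _ _ (8 * (D * Q))).
    by rewrite [leRHS]mulrCA ler_pM2l.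
  apply: (@le_trans _ _ (8 * (2 * c * (E * nr x)))); first by rewrite ler_pM2l.
  have -> : 8 * (2 * c * (E * nr x)) = 16 * c * (E * nr x) by ring.
  apply: ler_wpM2l; first by rewrite mulr_ge0.
  by apply: ler_wpM2r => //; exact: ltW.
have nx2 : 0 < nr x ^+ 2 by rewrite exprn_gt0.
have := d2; rewrite -(ltr_pM2r nx2) ltNge => /negP; apply.
move: f1; have -> : D * (nu * nr x) ^+ 2 = D * nu ^+ 2 * nr x ^+ 2 by ring.
by have -> : 16 * c * (d * nr x * nr x) = 16 * (c * d) * nr x ^+ 2 by ring.
Qed.

(** The left side is the form of the selfadjoint Z, hence at most ||Z|| |x|^2. If ||Z|| exceeded the
    bound, Z - l would be bounded below for both l = ||Z|| and l = -||Z||, and so would Z^2 -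
    ||Z||^2. *)
Lemma rinner_swap_le X Y (w : R) : bounded_op X -> bounded_op Y ->
  (forall x, `|rp (Y (X x)) x| <= w * nr x ^+ 2) -> 0 <= w ->
  forall x, 2 * rp (X (Y x)) x <= (w + opnorm X * opnorm Y) * nr x ^+ 2.
Proof.
move=> bX bY hw w0 x.
pose Z := (X \o Y) \+ (adjoint Y \o adjoint X).
have bXs := adjoint_bounded bX; have bYs := adjoint_bounded bY.
have bZ : bounded_op Z by apply: bounded_op_add; apply: bounded_op_comp.
have Zrp y z : rp (Z y) z = rp (X (Y y)) z + rp y (X (Y z)).
  rewrite rinnerDl /=; congr (_ + _).
  by rewrite rinnerC -adjoint_rinner // -adjoint_rinner // rinnerC.
have sZ : selfadjoint Z.
  by move=> y z; rewrite Zrp [RHS]rinnerC Zrp addrC (rinnerC y) (rinnerC _ z).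
have -> : 2 * rp (X (Y x)) x = rp (Z x) x by rewrite Zrp (rinnerC x); ring.
apply: le_trans (rinner_le _ _) _; rewrite expr2 mulrA.
apply: ler_wpM2r; first exact: rnorm_ge0.
apply: le_trans (opnorm_ub _ bZ) _; apply: ler_wpM2r; first exact: rnorm_ge0.
rewrite leNgt; apply/negP => lt.
have k0 : 0 <= w + opnorm X * opnorm Y by rewrite addr_ge0 // mulr_ge0 ?opnorm_ge0.
apply: (sq_not_bounded_below bZ sZ (le_lt_trans k0 lt)).
apply: bounded_below_sq; first exact: bounded_op_linear.
move=> l hl; apply: (@swap_bounded_below X Y w l) => //.
by rewrite hl ger0_norm ?opnorm_ge0.
Qed.

(** Replacing X by uX with a phase u makes <XYx, x> real and nonnegative; it changes neither the
    modulus of the form of YX nor the bound on ||X||. *)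
Lemma num_radius_swap X Y x : bounded_op X -> bounded_op Y ->
  2 * complex.Re `|ip (X (Y x)) x| <=
  (num_radius (Y \o X) + opnorm X * opnorm Y) * nr x ^+ 2.
Proof.
move=> bX bY; have [u u1 uz] := phase_exists (ip (X (Y x)) x).
pose X' := fun y => u *: X y.
have bX' : bounded_op X' by exact: bounded_op_scale.
have oX' : opnorm X' <= opnorm X.
  apply: opnorm_le => [|y]; first exact: opnorm_ge0.
  by rewrite rnormZ u1 mul1r opnorm_ub.
have -> : complex.Re `|ip (X (Y x)) x| = rp (X' (Y x)) x.
  by rewrite /X' /rinner innerZl uz.
apply: le_trans (@rinner_swap_le X' Y (num_radius (Y \o X)) bX' bY _ _ x) _.
- move=> y; rewrite /X' linopZ; last exact: bounded_op_linear.
  apply: le_trans (rinner_le_inner _ _) _.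
  have -> : complex.Re `|ip (u *: Y (X y)) y| = complex.Re `|ip (Y (X y)) y|.
    rewrite innerZl normrM; have -> : `|u| = 1; last by rewrite mul1r.
    by move: u1; rewrite normc_def /= => ->.
  exact: (@num_radius_ub _ _ (Y \o X) y (bounded_op_comp bY bX)).
- exact: num_radius_ge0.
- apply: ler_wpM2r; first exact: sqr_ge0.
  by rewrite lerD2l ler_wpM2r ?opnorm_ge0.
Qed.

(** The vector h is uT plus its adjoint, applied to x, so 2r = rp h x <= |h||x|. In |h|^2 the cross
    term is twice the real part of u^2 <T^2 x, x>, and the squares add up to the form of T*T +
    TT*. *)
Lemma inner_sq_le T x : bounded_op T ->
  complex.Re `|ip (T x) x| ^+ 2 <=
  (2^-1 * complex.Re `|ip (T (T x)) x| +
   4^-1 * rp (((adjoint T \o T) \+ (T \o adjoint T)) x) x) * nr x ^+ 2.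
Proof.
move=> bT; have [u u1 uz] := phase_exists (ip (T x) x).
set r := complex.Re _ in uz *.
pose h := u *: T x + Num.conj u *: adjoint T x.
have e1 : ip (adjoint T x) x = Num.conj (ip (T x) x) by rewrite innerC -adjointP.
have hr : 2 * r = rp h x.
  rewrite /h rinnerDl /rinner !innerZl e1 uz -rmorphM /= uz conjC_real /=; ring.
have nconj : complex.Re `|Num.conj u| = 1.
  by move: u1; rewrite !normc_def conjCE /= sqrrN.
have hn : nr h ^+ 2 <= rp (((adjoint T \o T) \+ (T \o adjoint T)) x) x +
    2 * complex.Re `|ip (T (T x)) x|.
  rewrite /h rnorm_sqD !rnormZ u1 nconj !mul1r.
  have -> : rp (((adjoint T \o T) \+ (T \o adjoint T)) x) x =
      nr (T x) ^+ 2 + nr (adjoint T x) ^+ 2.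
    by rewrite rinnerDl /= (rinnerC (adjoint T _)) -adjoint_rinner //
      (adjoint_rinner (adjoint T x) x bT) !rnorm_sq.
  have : rp (u *: T x) (Num.conj u *: adjoint T x) <= complex.Re `|ip (T (T x)) x|.
    apply: le_trans (ler_norm _) _; apply: le_trans (rinner_le_inner _ _) _.
    rewrite innerZl innerZr conjCK -adjointP // !normrM.
    by have -> : `|u| = 1; [move: u1; rewrite normc_def /= => -> | rewrite !mul1r].
  lra.
have h1 := rinner_norm_le h x; rewrite -hr in h1.
have : (2 * r) ^+ 2 <= (nr h * nr x) ^+ 2.
  by rewrite -real_normK ?num_real // ler_sqr ?nnegrE ?mulr_ge0 ?rnorm_ge0.
rewrite !exprMn => h2; have h3 := ler_wpM2r (sqr_ge0 (nr x)) hn; lra.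
Qed.

Lemma num_radius_sq_le T X Y : bounded_op T -> bounded_op X -> bounded_op Y ->
  T \o T = X \o Y ->
  num_radius T ^+ 2 <= 4^-1 * num_radius (Y \o X) + 4^-1 * (opnorm X * opnorm Y)
    + 4^-1 * opnorm ((adjoint T \o T) \+ (T \o adjoint T)).
Proof.
move=> bT bX bY TXY; set rhs := _ + _.
have n0 (A : H -> H) : 0 <= 4^-1 * opnorm A by rewrite mulr_ge0 ?opnorm_ge0.
have rhs0 : 0 <= rhs.
  by rewrite /rhs !addr_ge0 // mulr_ge0 ?num_radius_ge0 ?mulr_ge0 ?opnorm_ge0.
suff : num_radius T <= Num.sqrt rhs.
  move=> h; rewrite -(sqr_sqrtr rhs0) ler_sqr ?nnegrE ?sqrtr_ge0 //.
  exact: num_radius_ge0.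
apply: num_radius_le; first exact: sqrtr_ge0.
move=> x x1; apply: sq_le; rewrite ?sqrtr_ge0 // sqr_sqrtr //.
apply: le_trans (inner_sq_le x bT) _; rewrite x1 expr1n mulr1.
have -> : T (T x) = X (Y x) by have := congr1 (fun f => f x) TXY.
have h1 := num_radius_swap x bX bY; rewrite x1 expr1n mulr1 in h1.
set S := _ \+ _; have bS : bounded_op S.
  by apply: bounded_op_add; apply: bounded_op_comp => //; exact: adjoint_bounded.
have h2 : rp (S x) x <= opnorm S.
  apply: le_trans (rinner_le _ _) _; rewrite x1 mulr1.
  by apply: le_trans (opnorm_ub _ bS) _; rewrite x1 mulr1.
rewrite /rhs -/S; lra.
Qed.

End NumericalRadius.

(** * Absolute value and polar decomposition *)

Section PolarDecomposition.
Context {R : realType} {H : hilbertType R}.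
Implicit Types (A B T P U : H -> H) (x y z c k : H).

Local Notation ip := (@inner R H).
Local Notation rp := rinner.
Local Notation nr := rnorm.
Local Notation "c %:C" := (real_complex R c).

Lemma scaleii x : 'i%C *: ('i%C *: x) = - x.
Proof. by rewrite scalerA -expr2 sqr_i scaleN1r. Qed.

(** The imaginary part of <Ax, x> vanishes; polarizing at x + y gives [cross], and replacing y by iy
    turns it into symmetry of the real form. *)
Lemma positive_op_selfadjoint A : linear A -> positive_op A -> selfadjoint A.
Proof.
move=> lA pA; have im x : rp (A x) ('i%C *: x) = 0.
  by rewrite -Im_inner; apply: ger0_Im; exact: pA.
have cross x y : rp (A x) ('i%C *: y) + rp (A y) ('i%C *: x) = 0.
  have := im (x + y); rewrite (linopD lA) scalerDr !rinnerE !im; lra.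
move=> x y; have := cross x ('i%C *: y).
rewrite scaleii rinnerNr (linopZ lA) rinneri scaleii rinnerNr (rinnerC (A y)).
lra.
Qed.

Lemma selfadjoint_positive_op A : linear A -> selfadjoint A ->
  (forall x, 0 <= rp (A x) x) -> positive_op A.
Proof.
move=> lA sA pA x.
by rewrite inner_rinner selfadjoint_rinneri // complexr0 ler0c.
Qed.

Lemma positive_op_rinner A x : positive_op A -> 0 <= rp (A x) x.
Proof. by move=> pA; have := pA x; rewrite lecE => /andP[]. Qed.

Lemma op_absP T : bounded_op T ->
  [/\ bounded_op (op_abs T), positive_op (op_abs T) &
      op_abs T \o op_abs T = adjoint T \o T].
Proof.
move=> bT; have bTs := adjoint_bounded bT.
have bS := bounded_op_comp bTs bT.
have sS : selfadjoint (adjoint T \o T).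
  by move=> x y /=; rewrite rinnerC -!adjoint_rinner // rinnerC.
have pS x : 0 <= rp ((adjoint T \o T) x) x.
  by rewrite rinnerC /= -adjoint_rinner // rinner_ge0.
have [P [bP sP pP PP]] := func_calc_sqrt_exists bS sS pS.
rewrite /op_abs; case: xgetP => [P' _ //|/(_ P)]; case.
split=> //; apply: selfadjoint_positive_op => //; exact: bounded_op_linear.
Qed.

(** The vector [c_ x] is the orthogonal projection of x onto the closure of the range of P, obtained
    by representing the functional [rp _ x] on that range; x minus it lies in the kernel because P
    is selfadjoint. *)
Lemma range_ker_decomposition P : bounded_op P -> selfadjoint P ->
  exists c_ : H -> H, forall x,
  [/\ P (x - c_ x) = 0, forall k, P k = 0 -> rp (c_ x) k = 0 &
      forall e : R, 0 < e -> exists y, nr (P y - c_ x) < e].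
Proof.
move=> bP sP; have lP := bounded_op_linear bP.
suff h x : exists c, [/\ P (x - c) = 0, forall k, P k = 0 -> rp c k = 0 &
    forall e : R, 0 < e -> exists y, nr (P y - c) < e].
  by have [c_ hc] := choice h; exists c_.
have [|y z|a y|y|c hc hP] := @riesz_subspace _ _ (range P) (fun y => rp y x) (nr x).
- split; first by exists 0 => //; rewrite linop0.
    by move=> _ _ [y _ <-] [z _ <-]; exists (y + z) => //; rewrite linopD.
  by move=> a _ [y _ <-]; exists (a%:C *: y) => //; rewrite linopZ.
- by rewrite rinnerDl.
- by rewrite rinnerZl.
- by rewrite mulrC rinner_le.
exists c; split.
- apply: rinner_eq0 => y; rewrite sP rinnerC rinnerBr.
  by rewrite hP ?subrr //; exists y.
- move=> k Pk; apply/eqP; rewrite -normr_eq0 eq_le normr_ge0 andbT.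
  apply: (@le0_eps _ _ (nr k)); first exact: rnorm_ge0.
  move=> e e0 _; have [_ [y _ <-] hy] := hc e e0.
  have -> : rp c k = - rp (P y - c) k by rewrite rinnerBl sP Pk rinner0r; ring.
  rewrite normrN; apply: le_trans (rinner_norm_le _ _) _.
  by apply: ler_wpM2r; [exact: rnorm_ge0 | exact: ltW].
- by move=> e /hc[_ [y _ <-] hy]; exists y.
Qed.

Lemma rnorm_le_eps (x : H) (C : R) : 0 <= C ->
  (forall e : R, 0 < e -> e <= 1 -> nr x <= e * C) -> x = 0.
Proof.
move=> C0 h; apply/rnorm_eq0/eqP; rewrite eq_le rnorm_ge0 andbT.
exact: (le0_eps C0 h).
Qed.

(* U is the continuous extension of P y |-> T y from the range of P to its
   closure, composed with the projection onto that closure. *)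
Lemma polar_part_exists T P : bounded_op T -> bounded_op P -> selfadjoint P ->
  (forall x, nr (P x) = nr (T x)) ->
  exists U, [/\ partial_isometry U, (forall x, U x = 0 <-> T x = 0) & T = U \o P].
Proof.
move=> bT bP sP PT; have lT := bounded_op_linear bT; have lP := bounded_op_linear bP.
have kerE x : P x = 0 <-> T x = 0.
  by split=> h; apply: rnorm_eq0; [rewrite -PT h rnorm0 | rewrite PT h rnorm0].
have [c hc] := range_ker_decomposition bP sP.
have c_ker x : P (x - c x) = 0 by case: (hc x).
have c_orth x k : P k = 0 -> rp (c x) k = 0 by case: (hc x) => _ h _; exact: h.
(* Uniqueness of the splitting into kernel and orthogonal complement; linearity of c and its fixed
   points follow from it. *)
have c_uniq x z : P (x - z) = 0 -> (forall k, P k = 0 -> rp z k = 0) -> z = c x.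
  move=> h1 h2; have hk : P (z - c x) = 0.
    have -> : z - c x = (x - c x) - (x - z) by rewrite opprB [RHS]addrC subrKA.
    by rewrite linopB // c_ker h1 subrr.
  apply: subr0_eq; apply: rnorm_eq0; apply/eqP.
  by rewrite -sqrf_eq0 rnorm_sq rinnerBl h2 // c_orth // subrr.
have c_lin a x y : c (a *: x + y) = a *: c x + c y.
  symmetry; apply: c_uniq.
    have -> : a *: x + y - (a *: c x + c y) = a *: (x - c x) + (y - c y).
      by rewrite opprD addrACA scalerBr.
    by rewrite lP !c_ker scaler0 addr0.
  move=> k Pk; rewrite rinnerDl c_orth // addr0 /rinner innerZl inner_rinner.
  rewrite !c_orth ?complexr0 ?mulr0 //.
  by rewrite linopZ // Pk scaler0.
have hU x : exists v, forall e : R, 0 < e ->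
    exists y, nr (P y - c x) < e /\ nr (T y - v) < e.
  have [_ _ h] := hc x.
  have hy (n : nat) : exists y, nr (P y - c x) < n.+1%:R^-1.
    by apply: h; rewrite invr_gt0.
  have [y_ hy_] := choice hy.
  have [|v hv] := @rnorm_complete _ _ (fun n => T (y_ n)).
    move=> e e0; have e20 : 0 < e / 2 by rewrite divr_gt0.
    have [N hN] := invS_small e20; exists N => m n /hN hm /hN hn.
    rewrite -linopB // -PT linopB //.
    have -> : P (y_ m) - P (y_ n) = (P (y_ m) - c x) - (P (y_ n) - c x).
      by rewrite opprB subrKA.
    apply: le_lt_trans (rnormB _ _) _; rewrite (splitr e).
    by apply: ltrD; [exact: lt_trans (hy_ m) hm | exact: lt_trans (hy_ n) hn].
  exists v => e e0; have [N1 hN1] := hv e e0; have [N2 hN2] := invS_small e0.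
  pose n := maxn N1 N2; exists (y_ n); split; last by apply: hN1; exact: leq_maxl.
  by apply: lt_trans (hy_ n) _; apply: hN2; exact: leq_maxr.
have [U {}hU] := choice hU.
have lU : linear U.
  move=> a x z; apply: subr0_eq.
  apply: (@rnorm_le_eps _ (2 * (1 + complex.Re `|a| + 1))).
    by rewrite mulr_ge0 ?addr_ge0 ?normc_ge0.
  move=> e e0 _; have [y1 [p1 t1]] := hU x e e0; have [y2 [p2 t2]] := hU z e e0.
  have [y3 [p3 t3]] := hU (a *: x + z) e e0.
  (* Used twice: to bound the linearity defect of U by that of the vectors T y_i, and then, with
     approximants and limits exchanged, to bound the defect of the vectors P y_i by that of c, which
     is 0. *)
  have tri (u1 u2 u3 v1 v2 v3 : H) : nr (u3 - v3) < e -> nr (u1 - v1) < e ->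
      nr (u2 - v2) < e ->
      nr (v3 - (a *: v1 + v2)) <= nr (u3 - (a *: u1 + u2)) + e * (1 + complex.Re `|a| + 1).
    move=> h3 h1 h2.
    have -> : v3 - (a *: v1 + v2) = (u3 - (a *: u1 + u2)) +
        (- (u3 - v3) + (a *: (u1 - v1) + (u2 - v2))).
      rewrite scalerBr [X in _ + (_ + X)]addrACA -opprD addrA [X in _ = X + _]addrC.
      by rewrite opprB subrKA subrKA.
    apply: le_trans (rnormD _ _) _; apply: lerD => //.
    apply: le_trans (rnormD _ _) _; rewrite rnormN -addrA mulrDr mulr1; apply: lerD.
      exact: ltW.
    apply: le_trans (rnormD _ _) _; rewrite rnormZ mulrDr mulr1; apply: lerD; last exact: ltW.
    by rewrite mulrC; apply: ler_wpM2r; [exact: normc_ge0 | exact: ltW].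
  have h1 := tri _ _ _ _ _ _ t3 t1 t2.
  have h2 : nr (T y3 - (a *: T y1 + T y2)) = nr (P y3 - (a *: P y1 + P y2)).
    by rewrite -lT -lP -!linopB // PT.
  have q i j : nr (P i - c j) < e -> nr (c j - P i) < e by rewrite rnormBC.
  have h3 := tri _ _ _ _ _ _ (q _ _ p3) (q _ _ p1) (q _ _ p2).
  rewrite c_lin subrr rnorm0 add0r in h3.
  rewrite h2 in h1; apply: le_trans h1 _.
  rewrite mulrCA; lra.
have nU x : nr (U x) = nr (c x).
  apply/eqP; rewrite -subr_eq0 -normr_eq0 eq_le normr_ge0 andbT.
  apply: (@le0_eps _ _ 2) => // e e0 _; have [y [p t]] := hU x e e0.
  have h1 := rnorm_dist (U x) (T y); rewrite rnormBC -PT in h1.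
  have h2 := rnorm_dist (P y) (c x).
  have h3 := rnorm_dist (c x) (P y); rewrite rnormBC in h3.
  have h4 := rnorm_dist (T y) (U x); rewrite -PT in h4.
  rewrite ler_norml; apply/andP; split; lra.
have c_le x : nr (c x) <= nr x.
  apply: sq_le; first exact: rnorm_ge0.
  have -> : nr x ^+ 2 = nr (c x) ^+ 2 + nr (x - c x) ^+ 2.
    have := rnorm_sqD (x - c x) (c x).
    by rewrite subrK (rinnerC _ (c x)) c_orth // => ->; ring.
  by rewrite lerDl sqr_ge0.
have UE x : U x = 0 <-> P x = 0.
  split=> h.
    have cx : c x = 0 by apply: rnorm_eq0; rewrite -nU h rnorm0.
    by have := c_ker x; rewrite cx subr0.
  apply: rnorm_eq0; rewrite nU -(c_uniq x 0) ?rnorm0 ?subr0 // => k _.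
  exact: rinner0l.
exists U; split.
- split; first by apply: (bounded_op_of (c := 1)) => // x; rewrite mul1r nU.
  move=> x hx; rewrite !normr_rnorm nU -(c_uniq x x) //.
    by rewrite subrr linop0.
  by move=> k /UE /hx; rewrite inner_rinner => -[].
- by move=> x; rewrite UE kerE.
- apply: funext => x /=; apply: subr0_eq; apply: (@rnorm_le_eps _ 2) => // e e0 _.
  have [y [p t]] := hU (P x) e e0.
  have cP : c (P x) = P x.
    symmetry; apply: c_uniq; first by rewrite subrr linop0.
    by move=> k Pk; rewrite sP Pk rinner0r.
  rewrite cP -linopB // PT linopB // in p.
  have -> : T x - U (P x) = (T y - U (P x)) - (T y - T x).
    by rewrite opprB [RHS]addrC subrKA.
  by apply: le_trans (rnormB _ _) _; lra.
Qed.

Lemma polar_partP T : bounded_op T ->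
  [/\ partial_isometry (polar_part T),
      (forall x, polar_part T x = 0 <-> T x = 0) &
      T = polar_part T \o op_abs T].
Proof.
move=> bT; have [bP pP PP] := op_absP bT.
have sP := positive_op_selfadjoint (bounded_op_linear bP) pP.
have [|U hU] := polar_part_exists bT bP sP.
  move=> x; apply/eqP; rewrite -(eqrXn2 (n := 2)) ?rnorm_ge0 // !rnorm_sq.
  rewrite sP adjoint_rinner //.
  by have := congr1 (fun f => f x) PP => /= ->.
by rewrite /polar_part; case: xgetP => [U' _ //|/(_ U)].
Qed.

End PolarDecomposition.

(** * The powers of |T| and their strong continuity in the exponent *)

Section AbsolutePowers.
Context {R : realType} {H : hilbertType R}.
Implicit Types (x y z k : H) (t s : R).

Local Notation ip := (@inner R H).
Local Notation rp := rinner.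
Local Notation nr := rnorm.
Local Notation "c %:C" := (real_complex R c).

Variables (T : H -> H) (bT : bounded_op T).

Local Notation P := (op_abs T).
Local Notation U := (polar_part T).
Local Notation W := (abs_pow T).

Lemma op_abs_bounded : bounded_op P.
Proof. by have [] := op_absP bT. Qed.

Lemma op_abs_ge0 x : 0 <= rp (P x) x.
Proof. by have [_ h _] := op_absP bT; exact: positive_op_rinner. Qed.

Lemma op_abs_selfadjoint : selfadjoint P.
Proof.
by have [bP pP _] := op_absP bT; apply: positive_op_selfadjoint pP; case: bP.
Qed.

Lemma rnorm_op_abs x : nr (P x) = nr (T x).
Proof.
have [_ _ PP] := op_absP bT.
apply/eqP; rewrite -(eqrXn2 (n := 2)) ?rnorm_ge0 // !rnorm_sq.
rewrite op_abs_selfadjoint adjoint_rinner //.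
by have := congr1 (fun f => f x) PP => /= ->.
Qed.

Lemma opnorm_op_abs : opnorm P = opnorm T.
Proof.
apply/eqP; rewrite eq_le; apply/andP; split; apply: opnorm_le;
  rewrite ?opnorm_ge0 // => x.
  by rewrite rnorm_op_abs opnorm_ub.
by rewrite -rnorm_op_abs; apply: opnorm_ub op_abs_bounded.
Qed.

Lemma polar_part_bounded : bounded_op U.
Proof. by have [[]] := polar_partP bT. Qed.

Lemma polar_partE x : T x = U (P x).
Proof. by have [_ _ h] := polar_partP bT; rewrite [in LHS]h. Qed.

Lemma polar_part_eq0 x : U x = 0 <-> P x = 0.
Proof.
have [_ h _] := polar_partP bT; rewrite h.
by split=> e; apply: rnorm_eq0; [rewrite rnorm_op_abs e rnorm0 | rewrite -rnorm_op_abs e rnorm0].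
Qed.

Lemma inner_ker c k : (forall k, P k = 0 -> rp c k = 0) -> P k = 0 -> ip c k = 0.
Proof.
move=> h Pk; rewrite inner_rinner !h ?complexr0 //.
by rewrite linopZ ?Pk ?scaler0 //; exact: bounded_op_linear op_abs_bounded.
Qed.

Lemma polar_part_isometry c : (forall k, P k = 0 -> rp c k = 0) -> nr (U c) = nr c.
Proof.
move=> h; have [[_ iU] _ _] := polar_partP bT.
apply: complexI; rewrite -!normr_rnorm; apply: iU => k /polar_part_eq0 Pk.
exact: inner_ker.
Qed.

Lemma polar_part_rinner c d :
  (forall k, P k = 0 -> rp c k = 0) -> (forall k, P k = 0 -> rp d k = 0) ->
  rp (U c) (U d) = rp c d.
Proof.
move=> hc hd.
have hcd : nr (U (c + d)) = nr (c + d).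
  by apply: polar_part_isometry => k Pk; rewrite rinnerDl hc // hd // addr0.
have := rnorm_sqD c d; have := rnorm_sqD (U c) (U d).
rewrite -(linopD (bounded_op_linear polar_part_bounded)) hcd.
rewrite !polar_part_isometry //; lra.
Qed.

Lemma op_abs_orth_ker x k : P k = 0 -> rp (P x) k = 0.
Proof. by move=> Pk; rewrite op_abs_selfadjoint Pk rinner0r. Qed.

(** This is U*U|T| = |T| in weak form. U vanishes on the kernel of |T|, so z may be replaced by its
    component in the closure of the range, where U preserves inner products. *)
Lemma polar_part_op_abs x z : rp (U (P x)) (U z) = rp (P x) z.
Proof.
have [c hc] := range_ker_decomposition op_abs_bounded op_abs_selfadjoint.
have [h1 h2 _] := hc z.
have -> : U z = U (c z).
  apply: subr0_eq; rewrite -linopB; last exact: bounded_op_linear polar_part_bounded.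
  exact/polar_part_eq0.
rewrite polar_part_rinner //; last exact: op_abs_orth_ker.
apply/eqP; rewrite eq_sym -subr_eq0 -rinnerBr; apply/eqP.
exact: op_abs_orth_ker.
Qed.

Lemma polar_part_contraction x : nr (U x) <= nr x.
Proof.
have [c hc] := range_ker_decomposition op_abs_bounded op_abs_selfadjoint.
have [h1 h2 _] := hc x.
have -> : U x = U (c x).
  apply: subr0_eq; rewrite -linopB; last exact: bounded_op_linear polar_part_bounded.
  exact/polar_part_eq0.
rewrite polar_part_isometry //; apply: sq_le; first exact: rnorm_ge0.
have := rnorm_sqD (x - c x) (c x); rewrite subrK (rinnerC _ (c x)) h2 // => ->.
by rewrite mulr0 addr0 lerDr sqr_ge0.
Qed.

Lemma abs_pow0 : W 0 = adjoint U \o U.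
Proof. by rewrite /abs_pow eqxx. Qed.

Lemma abs_pow_pos t : 0 < t -> W t = func_calc (fun s => s `^ t) P.
Proof. by move=> t0; rewrite /abs_pow gt_eqF. Qed.

Lemma abs_pow0_op_abs : W 0 \o P = P.
Proof.
apply: funext => x; apply: rinner_inj => z; rewrite abs_pow0 /= rinnerC.
by rewrite -(adjoint_rinner _ _ polar_part_bounded) rinnerC polar_part_op_abs.
Qed.

Lemma op_abs_abs_pow0 : P \o W 0 = P.
Proof.
apply: funext => x; apply: rinner_inj => z; rewrite abs_pow0 /=.
rewrite op_abs_selfadjoint rinnerC -(adjoint_rinner _ _ polar_part_bounded).
by rewrite polar_part_op_abs rinnerC -op_abs_selfadjoint.
Qed.

Lemma abs_pow_calculus t : 0 < t <= 1 -> op_calculus (fun s => s `^ t) P (W t).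
Proof.
move=> ht; rewrite abs_pow_pos; last by case/andP: ht.
exact: (func_calc_powR op_abs_bounded op_abs_selfadjoint op_abs_ge0 ht).
Qed.

Lemma abs_pow_bounded t : 0 <= t <= 1 -> bounded_op (W t).
Proof.
move=> /andP[]; rewrite le_eqVlt => /orP[/eqP <- _|t0 t1].
  rewrite abs_pow0; apply: bounded_op_comp polar_part_bounded.
  exact: adjoint_bounded polar_part_bounded.
by have [] := @abs_pow_calculus t; rewrite ?t0.
Qed.

Lemma opnorm_abs_pow t : 0 <= t <= 1 -> opnorm (W t) <= opnorm T `^ t.
Proof.
move=> /andP[]; rewrite le_eqVlt => /orP[/eqP <- _|t0 t1].
  rewrite powRr0 abs_pow0; apply: opnorm_le => // x /=.
  have hU : opnorm U <= 1.
    by apply: opnorm_le => // z; rewrite mul1r polar_part_contraction.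
  apply: le_trans (adjoint_bound _ polar_part_bounded) _.
  apply: ler_pM; rewrite ?opnorm_ge0 ?rnorm_ge0 //.
  exact: polar_part_contraction.
have ht : 0 < t <= 1 by rewrite t0.
apply: (op_calculus_norm op_abs_bounded op_abs_selfadjoint op_abs_ge0 (abs_pow_calculus ht)).
by move=> s hs; rewrite -opnorm_op_abs; apply: powR_op_bound.
Qed.

(** At t = 0 and t = 1 one factor is U*U, which |T| absorbs on the side where it occurs; only the
    open interval uses the calculus. *)
Lemma abs_pow_compl t : 0 <= t <= 1 -> W (1 - t) \o W t = P.
Proof.
have W1 : W 1 = P.
  by rewrite abs_pow_pos // func_calc_powR1 //; [exact: op_abs_bounded
    | exact: op_abs_selfadjoint | exact: op_abs_ge0].
move=> /andP[]; rewrite le_eqVlt => /orP[/eqP <- _|t0].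
  by rewrite subr0 W1 op_abs_abs_pow0.
rewrite le_eqVlt => /orP[/eqP ->|t1].
  by rewrite subrr W1 abs_pow0_op_abs.
rewrite !abs_pow_pos ?subr_gt0 //; apply: func_calc_powR_compl.
- exact: op_abs_bounded.
- exact: op_abs_selfadjoint.
- exact: op_abs_ge0.
- by rewrite t0.
Qed.

Lemma abs_pow_ker t k : 0 <= t <= 1 -> P k = 0 -> W t k = 0.
Proof.
move=> /andP[]; rewrite le_eqVlt => /orP[/eqP <- _|t0 t1] Pk.
  rewrite abs_pow0 /=; have /polar_part_eq0 -> := Pk.
  by apply: linop0; exact: bounded_op_linear (adjoint_bounded polar_part_bounded).
have ht : 0 < t <= 1 by rewrite t0.
apply: (op_calculus_ker op_abs_bounded (abs_pow_calculus ht)) => //.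
by rewrite powR0 // gt_eqF.
Qed.

(** The factor |T| brings t = 0 into the functional calculus, since U*U|T| = |T| corresponds to
    s^1. *)
Lemma abs_pow_op_abs_calculus t : 0 <= t <= 1 ->
  op_calculus (fun s => s `^ (1 + t)) P (W t \o P).
Proof.
have cX := op_calculusX op_abs_bounded.
move=> /andP[]; rewrite le_eqVlt => /orP[/eqP <- _|t0 t1].
  rewrite abs_pow0_op_abs; apply: (op_calculus_ext cX) => s /andP[s0 _].
  by rewrite addr0 powRr1.
have ht : 0 < t <= 1 by rewrite t0.
have h1 s : 0 <= s <= opnorm P -> `|s `^ t| <= opnorm P `^ t by exact: powR_op_bound.
have h2 s : 0 <= s <= opnorm P -> `|s| <= opnorm P.
  by move=> /andP[s0 sM]; rewrite ger0_norm.
have h := op_calculus_mul op_abs_bounded h1 h2 (abs_pow_calculus ht) cX.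
apply: (op_calculus_ext h).
move=> s /andP[s0 _] /=; rewrite powRD; last by rewrite gt_eqF // addr_gt0.
by rewrite powRr1 // mulrC.
Qed.

Lemma abs_pow_lipschitz : exists2 K : R, 0 <= K & forall t t' y,
  0 <= t <= 1 -> 0 <= t' <= 1 ->
  nr (W t (P y) - W t' (P y)) <= K * `|t - t'| * nr y.
Proof.
exists (1 + opnorm P ^+ 3); first by rewrite addr_ge0 // exprn_ge0 // opnorm_ge0.
move=> t t' y ht ht'.
have h := op_calculus_sub (abs_pow_op_abs_calculus ht) (abs_pow_op_abs_calculus ht').
have [bD _] := h; apply: le_trans (opnorm_ub y bD) _.
apply: ler_wpM2r; first exact: rnorm_ge0.
apply: (op_calculus_norm op_abs_bounded op_abs_selfadjoint op_abs_ge0 h) => s hs.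
exact: powR_exponent_lipschitz.
Qed.

Definition strongly_continuous (A : R -> H -> H) := forall t x (e : R),
  0 <= t <= 1 -> 0 < e -> exists2 d : R, 0 < d &
  forall t', 0 <= t' <= 1 -> `|t - t'| < d -> nr (A t' x - A t x) < e.

Lemma opnorm_powR_le t : 0 <= t <= 1 -> opnorm T `^ t <= 1 + opnorm T.
Proof.
move=> /andP[t0 t1]; have T0 := opnorm_ge0 T.
have [T1|T1] := leP 1 (opnorm T).
  by apply: le_trans (ler1_powR T1 t1) _; rewrite lerDr.
apply: (@le_trans _ _ (1 `^ t)); last by rewrite powR1 lerDl.
by apply: ge0_ler_powR; rewrite ?nnegrE // ltW.
Qed.

(* As t -> 0 the powers |T|^t converge to U*U strongly but in general not in
   norm; on the range of |T| the convergence is Lipschitz in t. *)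
Lemma abs_pow_continuous : strongly_continuous W.
Proof.
move=> t x e ht e0.
have [c hc] := range_ker_decomposition op_abs_bounded op_abs_selfadjoint.
have [h1 _ h3] := hc x.
pose B := 1 + opnorm T; have B0 : 0 < B by rewrite ltr_pwDl // opnorm_ge0.
(* The error budget is e/4 for the Lipschitz term on the range, and e/4 for the distance to the
   range at each of t and t', where B bounds every ||W s||. *)
have d0 : 0 < e / (4 * B) by rewrite divr_gt0 // mulr_gt0.
have [y hy] := h3 _ d0.
have [K K0 hK] := abs_pow_lipschitz.
have den0 : 0 < 4 * (K * nr y + 1).
  by rewrite mulr_gt0 // ltr_wpDl // mulr_ge0 // rnorm_ge0.
exists (e / (4 * (K * nr y + 1))); first by rewrite divr_gt0.
move=> t' ht' htt.
have bW s : 0 <= s <= 1 -> linear (W s) by move=> /abs_pow_bounded[].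
have Wb s : 0 <= s <= 1 -> nr (W s (P y - c x)) <= e / 4.
  move=> hs; apply: le_trans (opnorm_ub _ (abs_pow_bounded hs)) _.
  have -> : e / 4 = B * (e / (4 * B)) by field; rewrite gt_eqF.
  apply: ler_pM; rewrite ?opnorm_ge0 ?rnorm_ge0 //; last exact: ltW.
  exact: le_trans (opnorm_abs_pow hs) (opnorm_powR_le hs).
(* W s annihilates x - c x, which lies in the kernel of |T|, so x may be replaced by c x. *)
have Wc s : 0 <= s <= 1 -> W s x = W s (P y) - W s (P y - c x).
  move=> hs; rewrite -linopB; last exact: bW.
  apply: subr0_eq; rewrite -linopB; last exact: bW.
  by rewrite subKr; exact: abs_pow_ker.
rewrite !Wc //.
have -> : W t' (P y) - W t' (P y - c x) - (W t (P y) - W t (P y - c x)) =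
  (W t' (P y) - W t (P y)) - (W t' (P y - c x) - W t (P y - c x)).
  by rewrite !opprB addrACA [RHS]addrACA; congr (_ + _); exact: addrC.
have g1 := hK t' t y ht' ht.
have g2 : K * `|t' - t| * nr y <= e / 4.
  rewrite distrC mulrAC.
  apply: (@le_trans _ _ ((K * nr y + 1) * (e / (4 * (K * nr y + 1))))).
    apply: ler_pM => //; first by rewrite mulr_ge0 // rnorm_ge0.
      by rewrite lerDl.
    exact: ltW.
  rewrite le_eqVlt; apply/orP; left; apply/eqP; field.
  by rewrite gt_eqF // ltr_wpDl // mulr_ge0 // rnorm_ge0.
have g3 := Wb t ht; have g4 := Wb t' ht'.
apply: le_lt_trans (rnormB _ _) _.
have g5 := rnormB (W t' (P y - c x)) (W t (P y - c x)).
lra.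
Qed.

End AbsolutePowers.

(** * Lower semicontinuity and attainment of the minimum *)

Section LowerSemicontinuity.
Context {R : realType} {H : hilbertType R}.
Implicit Types (x y z : H) (t : R).

Local Notation ip := (@inner R H).
Local Notation rp := rinner.
Local Notation nr := rnorm.

Definition lsc01 (F : R -> R) := forall t (c : R), 0 <= t <= 1 -> c < F t ->
  exists2 d : R, 0 < d & forall t', 0 <= t' <= 1 -> `|t - t'| < d -> c < F t'.

Lemma lsc01_min (F : R -> R) : lsc01 F -> (forall t, 0 <= F t) ->
  exists2 t, 0 <= t <= 1 & forall t', 0 <= t' <= 1 -> F t <= F t'.
Proof.
move=> lF F0; pose E := [set F t | t in [set` `[0, 1]%R]].
have hE : has_inf E.
  split; first by exists (F 0); exists 0 => //=; rewrite in_itv /= lexx ler01.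
  by exists 0 => _ [t _ <-].
have mF t : 0 <= t <= 1 -> inf E <= F t.
  by move=> ht; apply: ge_inf; [case: hE | exists t => //=; rewrite in_itv].
have hu (n : nat) : exists t, 0 <= t <= 1 /\ F t < inf E + n.+1%:R^-1.
  have n0 : 0 < n.+1%:R^-1 :> R by rewrite invr_gt0.
  have [r [t /= ht rE] h] := inf_adherent n0 hE.
  by exists t; rewrite rE; move: ht; rewrite in_itv.
have [u {}hu] := choice hu.
have [p [p01 /cluster_eventuallyP hp]] : ([set` `[0, 1]%R] `&` cluster (u @ \oo)) !=set0.
  apply: (@segment_compact R 0 1).
  by exists 0%N => // n _ /=; rewrite in_itv; case: (hu n).
rewrite /= in_itv /= in p01.
exists p => // t' ht'; apply: le_trans (mF _ ht').
rewrite leNgt; apply/negP => lt.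
(* Semicontinuity keeps F above this midpoint near the cluster point p, while late terms of the
   minimizing sequence have values below it. *)
pose c := (F p + inf E) / 2.
have cp : c < F p by rewrite /c; lra.
have [d d0 hd] := lF p c p01 cp.
have h2 : 0 < c - inf E by rewrite /c; lra.
have [N hN] := invS_small h2.
have d20 : 0 < d / 2 by rewrite divr_gt0.
have [k kN hk] := hp _ N d20.
have [k01 hFk] := hu k.
have hc : c < F (u k) by apply: hd => //; lra.
have := hN k kN; move: (k.+1%:R^-1) hFk => w; lra.
Qed.

Variable A : R -> H -> H.
Hypothesis bA : forall t, 0 <= t <= 1 -> bounded_op (A t).
Hypothesis cA : strongly_continuous A.

Lemma opnorm_lsc : lsc01 (fun t => opnorm (A t)).
Proof.
(* Negative c is split off because the bound [opnorm_le], used to find x, requires 0 <= c. *)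
move=> t c ht hc; have [c0|c0] := ltP c 0.
  by exists 1 => // t' _ _; apply: lt_le_trans c0 (opnorm_ge0 _).
have [x hx] : exists x, c * nr x < nr (A t x).
  apply: contrapT => /forallNP h; move: hc; rewrite ltNge => /negP; apply.
  by apply: opnorm_le => // x; rewrite leNgt; apply/negP.
have e0 : 0 < nr (A t x) - c * nr x by rewrite subr_gt0.
have [d d0 hd] := cA x ht e0; exists d => // t' ht' htt.
have h1 := hd t' ht' htt.
have h2 := rnorm_dist (A t x) (A t' x); rewrite rnormBC in h2.
have h3 := opnorm_ub x (bA ht').
have nx := rnorm_ge0 x.
by rewrite ltNge; apply/negP => h4; have := ler_wpM2r nx h4; lra.
Qed.

Lemma num_radius_lsc : lsc01 (fun t => num_radius (A t)).
Proof.
move=> t c ht hc; have [c0|c0] := ltP c 0.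
  by exists 1 => // t' _ _; apply: lt_le_trans c0 (num_radius_ge0 _).
have [x [x1 hx]] : exists x, nr x = 1 /\ c < complex.Re `|ip (A t x) x|.
  apply: contrapT => /forallNP h; move: hc; rewrite ltNge => /negP; apply.
  apply: num_radius_le => // x x1; rewrite leNgt; apply/negP => hx.
  exact: (h x).
have e0 : 0 < complex.Re `|ip (A t x) x| - c by rewrite subr_gt0.
have [d d0 hd] := cA x ht e0; exists d => // t' ht' htt.
have h1 := hd t' ht' htt.
have h3 := num_radius_ub1 (bA ht') x1.
have h2 : complex.Re `|ip (A t x) x| <=
    complex.Re `|ip (A t' x) x| + nr (A t' x - A t x).
  have h4 := inner_norm_le (A t x - A t' x) x; rewrite x1 mulr1 rnormBC in h4.
  apply: le_trans (_ : _ <= complex.Re `|ip (A t' x) x| + complex.Re `|ip (A t x - A t' x) x|) _.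
    have e : ip (A t x) x = ip (A t' x) x + ip (A t x - A t' x) x.
      by rewrite -innerDl addrC subrK.
    rewrite {1}e -lecR rmorphD /=.
    have nE (z : R[i]) : real_complex R (complex.Re `|z|) = `|z| by rewrite normc_def.
    by rewrite !nE ler_normD.
  by rewrite lerD2l.
lra.
Qed.

End LowerSemicontinuity.

(** * Stability of strong continuity *)

Section StrongContinuity.
Context {R : realType} {H : hilbertType R}.
Implicit Types (A B : R -> H -> H) (x : H) (t : R).

Local Notation nr := rnorm.

(** The difference splits into A_t' (B_t' - B_t) x and (A_t' - A_t) B_t x; the first term calls for
    a norm bound on A_t' that does not depend on t'. *)
Lemma strongly_continuous_comp A B (K : R) :
  (forall t, 0 <= t <= 1 -> bounded_op (A t)) ->
  (forall t, 0 <= t <= 1 -> opnorm (A t) <= K) ->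
  strongly_continuous A -> strongly_continuous B ->
  strongly_continuous (fun t => A t \o B t).
Proof.
move=> bA hK cA cB t x e ht e0.
have K0 : 0 <= K by apply: le_trans (hK t ht); exact: opnorm_ge0.
have K1 : 0 < 2 * (K + 1) by rewrite mulr_gt0 // ltr_wpDl.
have e1 : 0 < e / (2 * (K + 1)) by rewrite divr_gt0.
have e2 : 0 < e / 2 by rewrite divr_gt0.
have [d1 d10 hd1] := cB t x _ ht e1.
have [d2 d20 hd2] := cA t (B t x) _ ht e2.
exists (Num.min d1 d2); first by rewrite lt_min d10.
move=> t' ht'; rewrite lt_min => /andP[h1 h2] /=.
have -> : A t' (B t' x) - A t (B t x) =
    A t' (B t' x - B t x) + (A t' (B t x) - A t (B t x)).
  by rewrite (linopB (bounded_op_linear (bA t' ht'))) subrKA.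
apply: le_lt_trans (rnormD _ _) _; rewrite (splitr e).
apply: ler_ltD; last exact: hd2.
apply: le_trans (opnorm_ub _ (bA t' ht')) _.
apply: (@le_trans _ _ (K * (e / (2 * (K + 1))))).
  by apply: ler_pM; rewrite ?opnorm_ge0 ?rnorm_ge0 ?hK // ltW // hd1.
rewrite mulrA ler_pdivrMr //.
have -> : e / 2 * (2 * (K + 1)) = K * e + e by field.
by rewrite lerDl ltW.
Qed.

Lemma strongly_continuous_const (S : H -> H) : strongly_continuous (fun _ => S).
Proof. by move=> t x e _ e0; exists 1 => // t' _ _; rewrite subrr rnorm0. Qed.

Lemma strongly_continuous_rev A :
  strongly_continuous A -> strongly_continuous (fun t => A (1 - t)).
Proof.
move=> cA t x e ht e0; have ht1 : 0 <= 1 - t <= 1 by lra.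
have [d d0 hd] := cA _ x e ht1 e0; exists d => // t' ht' htt.
apply: hd; first lra.
have -> : 1 - t - (1 - t') = - (t - t') by ring.
by rewrite normrN.
Qed.

End StrongContinuity.

(** * The Aluthge transform and the final estimate *)

Section Aluthge.
Context {R : realType} {H : hilbertType R}.
Implicit Types (t : R).
Variables (T : H -> H) (bT : bounded_op T).

Local Notation U := (polar_part T).
Local Notation W := (abs_pow T).

Lemma compl01 t : 0 <= t <= 1 -> 0 <= 1 - t <= 1.
Proof. by move=> ht; lra. Qed.

Lemma aluthge_bounded t : 0 <= t <= 1 -> bounded_op (aluthge t T).
Proof.
move=> ht; apply: bounded_op_comp (abs_pow_bounded bT (compl01 ht)).
by apply: bounded_op_comp (polar_part_bounded bT); exact: abs_pow_bounded.
Qed.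

Lemma opnorm_polar_part : opnorm U <= 1.
Proof. by apply: opnorm_le => // x; rewrite mul1r polar_part_contraction. Qed.

Lemma opnorm_comp_le (A B : H -> H) (a b : R) : bounded_op A -> bounded_op B ->
  opnorm A <= a -> opnorm B <= b -> opnorm (A \o B) <= a * b.
Proof.
move=> bA bB hA hB.
have a0 : 0 <= a by apply: le_trans hA; exact: opnorm_ge0.
have b0 : 0 <= b by apply: le_trans hB; exact: opnorm_ge0.
apply: opnorm_le => [|x /=]; first exact: mulr_ge0.
apply: le_trans (opnorm_ub _ bA) _; rewrite -mulrA.
apply: ler_pM; rewrite ?opnorm_ge0 ?rnorm_ge0 //.
apply: le_trans (opnorm_ub _ bB) _.
by apply: ler_wpM2r; rewrite ?rnorm_ge0.
Qed.

Lemma opnorm_aluthge_le t : 0 <= t <= 1 ->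
  opnorm (aluthge t T) <= (1 + opnorm T) * 1 * (1 + opnorm T).
Proof.
move=> ht; have hW s : 0 <= s <= 1 -> opnorm (W s) <= 1 + opnorm T.
  by move=> hs; apply: le_trans (opnorm_abs_pow bT hs) (opnorm_powR_le T hs).
have bW := abs_pow_bounded bT ht; have bU := polar_part_bounded bT.
apply: opnorm_comp_le (abs_pow_bounded bT (compl01 ht)) _ (hW _ (compl01 ht)).
  exact: bounded_op_comp.
exact: opnorm_comp_le bW bU (hW _ ht) opnorm_polar_part.
Qed.

Lemma aluthge_continuous : strongly_continuous (fun t => aluthge t T).
Proof.
have cW := abs_pow_continuous bT.
have bW := fun t => @abs_pow_bounded _ _ T bT t.
have hW s : 0 <= s <= 1 -> opnorm (W s) <= 1 + opnorm T.
  by move=> hs; apply: le_trans (opnorm_abs_pow bT hs) (opnorm_powR_le T hs).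
apply: (@strongly_continuous_comp _ _ (fun t => W t \o U) _ ((1 + opnorm T) * 1)).
- by move=> t ht; apply: bounded_op_comp (polar_part_bounded bT); exact: bW.
- move=> t ht; apply: opnorm_comp_le (bW t ht) (polar_part_bounded bT) (hW t ht) _.
  exact: opnorm_polar_part.
- apply: (strongly_continuous_comp bW hW) => //; exact: strongly_continuous_const.
- exact: strongly_continuous_rev.
Qed.

Lemma aluthge_bound_lsc : lsc01 (fun t =>
  4^-1 * num_radius (aluthge t T \o aluthge t T) + 4^-1 * (opnorm T * opnorm (aluthge t T))).
Proof.
have bA t (ht : 0 <= t <= 1) := aluthge_bounded ht.
have cA := aluthge_continuous.
have l1 := opnorm_lsc bA cA.
have l2 : lsc01 (fun t => num_radius (aluthge t T \o aluthge t T)).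
  apply: num_radius_lsc => [t ht|]; first by apply: bounded_op_comp; exact: bA.
  exact: (strongly_continuous_comp bA opnorm_aluthge_le cA cA).
move=> t c ht; set w := num_radius _; set a := opnorm (aluthge t T); set M := opnorm T.
move=> hc; have M0 : 0 <= M by exact: opnorm_ge0.
pose g := 4^-1 * w + 4^-1 * (M * a) - c; have g0 : 0 < g by rewrite subr_gt0.
have M1 : 0 < M + 1 by rewrite ltr_wpDl.
have h1 : w - g < num_radius (aluthge t T \o aluthge t T) by rewrite gtrBl.
(* The two losses are at most g/4 each, so the total stays below the gap g; dividing by M + 1 also
   covers M = 0. *)
have q0 : 0 < g / (M + 1) by rewrite divr_gt0.
have h2 : a - g / (M + 1) < opnorm (aluthge t T) by rewrite gtrBl.
have [d1 d10 hd1] := l2 t _ ht h1; have [d2 d20 hd2] := l1 t _ ht h2.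
exists (Num.min d1 d2); first by rewrite lt_min d10.
move=> t' ht'; rewrite lt_min => /andP[e1 e2].
have {hd1} f1 := hd1 t' ht' e1; have {hd2} f2 := hd2 t' ht' e2.
have f3 := ler_wpM2l M0 (ltW f2).
have q1 : M * (g / (M + 1)) <= g.
  by rewrite mulrA ler_pdivrMr // [leRHS]mulrDr mulr1 (mulrC M) lerDl ltW.
rewrite mulrBr in f3; move: (M * (g / (M + 1))) q1 f3 => q q1 f3.
have cE : c = 4^-1 * w + 4^-1 * (M * a) - g by rewrite /g; ring.
lra.
Qed.

Lemma num_radius_sq_aluthge t : 0 <= t <= 1 ->
  num_radius T ^+ 2 <=
    4^-1 * num_radius (aluthge t T \o aluthge t T)
    + 4^-1 * (opnorm T * opnorm (aluthge t T))
    + 4^-1 * opnorm ((adjoint T \o T) \+ (T \o adjoint T)).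
Proof.
move=> ht; pose X := U \o W (1 - t) \o aluthge t T.
have bU := polar_part_bounded bT.
have bW := abs_pow_bounded bT ht; have bW' := abs_pow_bounded bT (compl01 ht).
have bA := aluthge_bounded ht.
have bX : bounded_op X by do 2 apply: bounded_op_comp => //.
have TT : T \o T = X \o W t.
  apply: funext => x; rewrite /X /aluthge /=.
  have h y : W (1 - t) (W t y) = op_abs T y.
    by have := congr1 (fun f => f y) (abs_pow_compl bT ht).
  (* T^2 = U|T|U|T|, with each |T| split as |T|^(1-t) |T|^t. The product in the other order,
     [W t \o X], unfolds to the square of the transform. *)
  by rewrite !h -!polar_partE.
apply: le_trans (num_radius_sq_le bT bX bW TT) _.
rewrite lerD2r lerD2l ler_pM2l ?invr_gt0 //.
have hX : opnorm X <= 1 * opnorm T `^ (1 - t) * opnorm (aluthge t T).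
  apply: opnorm_comp_le => //; first exact: bounded_op_comp.
  apply: opnorm_comp_le => //; first exact: opnorm_polar_part.
  exact: opnorm_abs_pow (compl01 ht).
apply: le_trans (ler_pM (opnorm_ge0 _) (opnorm_ge0 _) hX (opnorm_abs_pow bT ht)) _.
(* The exponents 1 - t and t add up to 1, which is nonzero, so the powers of ||T|| multiply to ||T||
   even when ||T|| = 0. *)
rewrite mul1r mulrAC -powRD ?subrK ?oner_eq0 // powRr1 ?opnorm_ge0 //.
Qed.

End Aluthge.

Theorem theorem2p9 (R : realType) (H : hilbertType R) (T : H -> H)
    (hT : bounded_op T) :
  (exists2 m : R,
     is_min [set 4^-1 * num_radius (aluthge t T \o aluthge t T)
                 + 4^-1 * (opnorm T * opnorm (aluthge t T))
            | t in `[0, 1]] m &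
     num_radius T ^+ 2
       <= m + 4^-1 * opnorm ((adjoint T \o T) \+ (T \o adjoint T)))
  /\
  num_radius T ^+ 2
    <= 4^-1 * num_radius (aluthge 2^-1 T \o aluthge 2^-1 T)
       + 4^-1 * (opnorm T * opnorm (aluthge 2^-1 T))
       + 4^-1 * opnorm ((adjoint T \o T) \+ (T \o adjoint T)).
Proof.
split; last first.
  by apply: num_radius_sq_aluthge => //; rewrite invr_ge0 ler0n /= invf_le1 // ler1n.
have [t|t ht tmin] := lsc01_min (aluthge_bound_lsc hT).
  by rewrite addr_ge0 // !mulr_ge0 ?num_radius_ge0 ?opnorm_ge0.
exists (4^-1 * num_radius (aluthge t T \o aluthge t T)
                 + 4^-1 * (opnorm T * opnorm (aluthge t T))).
  split; first by exists t => //=; rewrite in_itv.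
  by move=> _ [t' /= ht' <-]; apply: tmin; move: ht'; rewrite in_itv.
exact: num_radius_sq_aluthge.
Qed.
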